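(* Let $\gamma(s)=(x(s),y(s))$ be a parabolic soliton of the inverse curve shortening flow in $\mathbb{H}^2$, i.e. the first two components of the maximal solution $(x(s),y(s),\theta(s))$, $s\in(s_m,s_M)$, of $$x'=\cos\theta,\qquad y'=\sin\theta,\qquad \theta'=\frac{1}{\sin\theta}-\frac{\cos\theta}{y}$$ with initial conditions $(x(0),y(0),\theta(0))=(0,y_0,\pi/2)$, $y_0>0$. Then $\gamma$ is a graph on the $y$-axis. Moreover, there exists a constant $H>0$ such that: (1) If $0<y_0<H$, then $\gamma$ approaches the line $y=0$ orthogonally, and there exists a constant $Y>0$ such that the line $y=Y$ is a horizontal asymptote of $\gamma$ (type I). (2) If $y_0>H$, then $\gamma$ is a graph on a bounded interval $(m,M)$ of the $y$-axis (type II). Writing $\gamma$ as $x=x(y)$, the function $x(y)$ is concave and satisfies $$\lim_{y\to M}x'(y)=-\infty,\qquad \lim_{y\to m}x'(y)=\infty.$$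
   Context: $\mathbb{H}^2$ is the upper half-plane $\{(x,y)\in\mathbb{R}^2: y>0\}$ with metric $(dx^2+dy^2)/y^2$. For a regular curve $\gamma=(x,y)$, the unit normal is $N=y\,(-y',x')/\sqrt{x'^2+y'^2}$ and the hyperbolic curvature is $\kappa=y\kappa_e+x'/\sqrt{x'^2+y'^2}$, where $\kappa_e=(x'y''-x''y')/(x'^2+y'^2)^{3/2}$. A parabolic soliton of the inverse curve shortening flow is a curve satisfying $1/\kappa=-\langle N,\partial_x\rangle$; when $\gamma$ is parametrized by Euclidean arc length with $x'=\cos\theta$, $y'=\sin\theta$, this is equivalent to the displayed system (for which $\sin\theta\neq 0$, so that here $\theta\in(0,\pi)$). A curve is a graph on the $y$-axis if it can be written as $x=x(y)$. That $\gamma$ approaches the line $y=0$ orthogonally means that toward one end of $\gamma$ one has $y\to0$ and the (Euclidean) tangent direction tends to the vertical direction ($\theta\to\pi/2$). $H$ does not depend on $y_0$.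
   Formalization: In (1), ''horizontal asymptote y=Y'' is read as: toward one end y→Y and the tangent direction becomes horizontal. The usual sense (|x|→∞) is false: θ'≥1 for s≥0 gives s_M≤π/2, so x stays bounded and the curve ends at a finite point of the line. *)

(* Defs.v *)
From Stdlib Require Import Reals.
From Coquelicot Require Import Coquelicot.

Local Open Scope R_scope.

(** The open interval (a, b), with possibly infinite ends. *)
Definition in_itv (a b : Rbar) (s : R) : Prop :=
  Rbar_lt a s /\ Rbar_lt s b.

(** The phase space of the system is y > 0, 0 < theta < PI: the curve lies in
    the upper half-plane and [sin theta] stays positive, so that the totalized
    divisions below are genuine. *)
Record solution (y0 : R) (sm sM : Rbar) (x y theta : R -> R) : Prop := {
  sol_left : Rbar_lt sm 0;
  sol_right : Rbar_lt 0 sM;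
  sol_y_pos : forall s, in_itv sm sM s -> 0 < y s;
  sol_theta_range : forall s, in_itv sm sM s -> 0 < theta s < PI;
  sol_x : forall s, in_itv sm sM s -> is_derive x s (cos (theta s));
  sol_y : forall s, in_itv sm sM s -> is_derive y s (sin (theta s));
  sol_theta : forall s, in_itv sm sM s ->
    is_derive theta s (1 / sin (theta s) - cos (theta s) / y s);
  sol_x0 : x 0 = 0;
  sol_y0 : y 0 = y0;
  sol_theta0 : theta 0 = PI / 2
}.

(** Maximality is the absence of a proper extension.  The values of [x], [y],
    [theta] outside (sm, sM) are irrelevant. *)
Definition maximal_solution (y0 : R) (sm sM : Rbar) (x y theta : R -> R)
    : Prop :=
  solution y0 sm sM x y theta /\
  forall (tm tM : Rbar) (u v w : R -> R),
    solution y0 tm tM u v w ->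
    Rbar_le tm sm -> Rbar_le sM tM ->
    (forall s, in_itv sm sM s -> u s = x s /\ v s = y s /\ w s = theta s) ->
    tm = sm /\ tM = sM.

(** The trace of the curve is { (f t, t) | t in J }. *)
Definition graph_over (J : R -> Prop) (f : R -> R) (sm sM : Rbar)
    (x y : R -> R) : Prop :=
  forall a t : R,
    (exists s, in_itv sm sM s /\ x s = a /\ y s = t) <-> (J t /\ a = f t).

Definition graph_on_y_axis (sm sM : Rbar) (x y : R -> R) : Prop :=
  exists (J : R -> Prop) (f : R -> R), graph_over J f sm sM x y.

Definition left_end (sm : Rbar) : (R -> Prop) -> Prop :=
  within (fun s : R => Rbar_lt sm s) (Rbar_locally sm).

Definition right_end (sM : Rbar) : (R -> Prop) -> Prop :=
  within (fun s : R => Rbar_lt s sM) (Rbar_locally sM).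

Definition is_end (sm sM : Rbar) (F : (R -> Prop) -> Prop) : Prop :=
  F = left_end sm \/ F = right_end sM.

Definition approaches_boundary_orthogonally (sm sM : Rbar) (y theta : R -> R)
    : Prop :=
  exists F : (R -> Prop) -> Prop, is_end sm sM F /\
    filterlim y F (locally 0) /\ filterlim theta F (locally (PI / 2)).

(** Toward one end the curve approaches the line y = Y and its tangent
    direction tends to the direction of that line.  There is no requirement
    that |x| tend to infinity: for the system above [theta' >= 1] for s > 0, so
    sM <= PI / 2 and [x] stays bounded at the end where theta tends to PI. *)
Definition horizontal_asymptote (Y : R) (sm sM : Rbar) (y theta : R -> R)
    : Prop :=
  exists F : (R -> Prop) -> Prop, is_end sm sM F /\
    filterlim y F (locally Y) /\
    (filterlim theta F (locally 0) \/ filterlim theta F (locally PI)).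

Definition concave_on (m M : R) (f : R -> R) : Prop :=
  forall a b t : R, m < a < M -> m < b < M -> 0 <= t <= 1 ->
    t * f a + (1 - t) * f b <= f (t * a + (1 - t) * b).

(* Main.v *)
(* For theta in (0, PI) put v = y - sin theta cos theta, so that
   theta' = v / (y sin theta).  The function v crosses zero only upwards, and
   theta' >= 1 for s >= 0, so the right end lies at finite s, where theta -> PI
   at positive height.  Towards the left end there are two cases.

   If v becomes nonpositive, theta increases from there towards the left end,
   and both y -> 0 and theta -> PI / 2.  If v > 0 throughout, theta decreases
   to 0, so the curve passes theta = PI / 4, where v > 0 means y > 1 / 2.  In
   the second case the curve is also a graph y = Y(theta), with
   dY/dtheta = sin^2 theta Y / (Y - sin theta cos theta), whose right-hand side
   decreases in Y.  Hence any soliton starting higher, by d > 0, stays at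
   least d higher as theta decreases: it is again of the second kind and stays
   away from y = 0, which makes it a concave graph over a bounded interval.
   H is the infimum of the initial heights of the second kind.

   Maximality enters through Picard iteration: a solution that converges
   inside the phase space at a finite end can be continued. *)

Require Import Defs.
From Stdlib Require Import Reals Ranalysis5 PSeries_reg Lra Lia Classical.
From Coquelicot Require Import Coquelicot.

Local Open Scope R_scope.

(** * Local existence by Picard iteration *)

(** The right-hand side is singular at [y = 0] and at [sin theta = 0], while Picard iteration is
    simplest for a globally Lipschitz field. Hence the denominators are first cut off from below,
    and a short-time solution is recognized afterwards as one that stays where the cut-off is
    inactive. As [x] does not occur on the right, only the pair [(y, theta)] is iterated, and [x] is
    recovered by integration. Maximality alone does not give the vertical limit in the first case:
    there [y] tends to 0, so the limit point lies outside the phase space whatever the limiting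
    angle is, and the angle has to be found from the divergence of [ln y]. Two solitons are compared
    at equal angle rather than at equal time, because then their [sin] and [cos] terms coincide, and
    the [excess] (the [v] above) of one is that of the other plus the difference of heights. All
    solitons share the starting angle [PI / 2], so this turns into a statement about initial
    heights. *)

Lemma between_shrink (a b s : R) :
  Rmin a b <= s <= Rmax a b -> Rabs (s - a) <= Rabs (b - a).
Proof.
  intros [h1 h2]; unfold Rmin, Rmax in *; destruct (Rle_dec a b);
    unfold Rabs; destruct (Rcase_abs (s - a)), (Rcase_abs (b - a)); lra.
Qed.

Lemma derive_bound_increment (F dF : R -> R) (a b K : R) :
  (forall s, Rmin a b <= s <= Rmax a b -> is_derive F s (dF s)) ->
  (forall s, Rmin a b <= s <= Rmax a b -> Rabs (dF s) <= K) ->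
  Rabs (F b - F a) <= K * Rabs (b - a).
Proof.
  intros dv bd.
  destruct (MVT_gen F a b dF) as [c [hc e]].
  - intros s hs; apply dv; lra.
  - intros s hs; apply continuity_pt_filterlim.
    apply (ex_derive_continuous F); eexists; apply dv, hs.
  - rewrite e, Rabs_mult.
    apply Rmult_le_compat_r; [apply Rabs_pos | apply bd, hc].
Qed.

Lemma geometric_increments_close (a : nat -> R) (K : R) :
  (forall n, Rabs (a (S n) - a n) <= K / 2 ^ n) ->
  forall n k, Rabs (a (n + k)%nat - a n) <= 2 * K / 2 ^ n.
Proof.
  intros inc n k.
  (* The exact partial geometric sum is what closes under induction; the factor [1 - 1 / 2 ^ k] is
     dropped afterwards. *)
  assert (bd : Rabs (a (n + k)%nat - a n) <= 2 * K / 2 ^ n * (1 - 1 / 2 ^ k)).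
  { induction k as [|k IH].
    - rewrite Nat.add_0_r, Rminus_diag, Rabs_R0; simpl; lra.
    - rewrite Nat.add_succ_r.
      replace (a (S (n + k)) - a n)
        with ((a (S (n + k)) - a (n + k)%nat) + (a (n + k)%nat - a n)) by ring.
      eapply Rle_trans; [apply Rabs_triang|].
      eapply Rle_trans; [apply Rplus_le_compat; [apply inc | apply IH]|].
      rewrite pow_add; simpl.
      assert (2 ^ n <> 0) by (apply pow_nonzero; lra).
      assert (2 ^ k <> 0) by (apply pow_nonzero; lra).
      right; field; split; assumption. }
  assert (K0 : 0 <= K).
  { generalize (inc 0%nat) (Rabs_pos (a 1%nat - a 0%nat)); simpl; lra. }
  eapply Rle_trans; [apply bd|].
  assert (0 < 2 ^ n) by (apply pow_lt; lra).
  assert (0 < 1 / 2 ^ k).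
  { apply Rdiv_lt_0_compat; [lra | apply pow_lt; lra]. }
  assert (0 <= 2 * K / 2 ^ n).
  { apply Rmult_le_pos; [lra | left; apply Rinv_0_lt_compat; assumption]. }
  nra.
Qed.

Lemma half_pow_small (K eps : R) : 0 < eps ->
  exists N, forall n, (N <= n)%nat -> K / 2 ^ n < eps.
Proof.
  intros he.
  assert (lim : is_lim_seq (fun n => K * (/ 2) ^ n) (Rbar_mult K 0)).
  { apply is_lim_seq_scal_l, is_lim_seq_geom.
    rewrite Rabs_pos_eq; lra. }
  replace (Rbar_mult K 0) with (Finite 0) in lim by (simpl; f_equal; ring).
  apply is_lim_seq_spec in lim.
  destruct (lim (mkposreal eps he)) as [N hN].
  exists N; intros n hn; specialize (hN n hn); simpl in hN.
  rewrite Rminus_0_r in hN.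
  eapply Rle_lt_trans; [|apply hN].
  unfold Rdiv; rewrite pow_inv; apply Rle_abs.
Qed.

Lemma geometric_increments_limit (a : nat -> R) (K : R) :
  (forall n, Rabs (a (S n) - a n) <= K / 2 ^ n) ->
  Un_cv a (real (Lim_seq a)) /\
  forall n, Rabs (real (Lim_seq a) - a n) <= 2 * K / 2 ^ n.
Proof.
  intros inc.
  assert (close := geometric_increments_close a K inc).
  assert (cv : Un_cv a (real (Lim_seq a))).
  { apply is_lim_seq_Reals.
    apply Lim_seq_correct', ex_lim_seq_cauchy_corr.
    intros eps.
    destruct (half_pow_small (2 * K) (eps / 2)) as [N hN].
    { generalize (cond_pos eps); lra. }
    assert (aux : forall n, (N <= n)%nat -> Rabs (a n - a N) < eps / 2).
    { intros n hn; replace n with (N + (n - N))%nat by lia.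
      eapply Rle_lt_trans; [apply close | apply hN; lia]. }
    exists N; intros n m hn hm.
    replace (a n - a m) with ((a n - a N) + - (a m - a N)) by ring.
    eapply Rle_lt_trans; [apply Rabs_triang|].
    rewrite Rabs_Ropp; generalize (aux n hn) (aux m hm); lra. }
  split; [exact cv|].
  (* A violation leaves a positive margin; a later term within that margin of the limit would break
     the bound between two terms. *)
  intros n; apply Rnot_lt_le; intros lt.
  destruct (cv (Rabs (real (Lim_seq a) - a n) - 2 * K / 2 ^ n)) as [N hN].
  { lra. }
  specialize (hN (n + N)%nat ltac:(lia)); unfold Rdist in hN.
  specialize (close n N).
  revert hN; apply Rle_not_lt.
  replace (real (Lim_seq a) - a n)
    with (- (a (n + N)%nat - real (Lim_seq a)) + (a (n + N)%nat - a n)) by ring.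
  generalize (Rabs_triang (- (a (n + N)%nat - real (Lim_seq a)))
                          (a (n + N)%nat - a n)).
  rewrite Rabs_Ropp; lra.
Qed.

(** The condition is global, in the sum norm, so that Picard iterates need no box to stay in. *)
Definition lipschitz2 (L : R) (f : R -> R -> R) : Prop :=
  forall p q p' q', Rabs (f p q - f p' q') <= L * (Rabs (p - p') + Rabs (q - q')).

Lemma lipschitz2_continuous (L : R) (f : R -> R -> R) (p q : R -> R) (s : R) :
  0 < L -> lipschitz2 L f -> continuous p s -> continuous q s ->
  continuous (fun t => f (p t) (q t)) s.
Proof.
  intros L0 lip cp cq; apply filterlim_locally; intros eps.
  assert (e0 : 0 < eps / (2 * L)).
  { apply Rdiv_lt_0_compat; [apply cond_pos | lra]. }
  generalize (filter_and _ _
    (proj1 (filterlim_locally p (p s)) cp (mkposreal _ e0))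
    (proj1 (filterlim_locally q (q s)) cq (mkposreal _ e0))).
  apply filter_imp; intros t [h1 h2].
  change (Rabs (p t - p s) < eps / (2 * L)) in h1.
  change (Rabs (q t - q s) < eps / (2 * L)) in h2.
  change (Rabs (f (p t) (q t) - f (p s) (q s)) < eps).
  eapply Rle_lt_trans; [apply lip|].
  replace (pos eps) with (L * (eps / (2 * L) + eps / (2 * L))) by (field; lra).
  apply Rmult_lt_compat_l; lra.
Qed.

Definition primitive_from (c p0 : R) (phi : R -> R) (s : R) : R :=
  p0 + RInt phi c s.

Lemma primitive_from_start (c p0 : R) (phi : R -> R) :
  primitive_from c p0 phi c = p0.
Proof. unfold primitive_from; rewrite RInt_point; apply Rplus_0_r. Qed.

Lemma ball_open (c h s : R) :
  Rabs (s - c) < h -> locally s (fun t => Rabs (t - c) < h).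
Proof.
  intros hs; apply Rabs_def2 in hs.
  generalize (filter_and (F := locally s) _ _ (open_gt (c - h) s ltac:(lra))
                                              (open_lt (c + h) s ltac:(lra))).
  apply filter_imp; intros t [h1 h2]; apply Rabs_def1; lra.
Qed.

Lemma primitive_from_derive (c h p0 : R) (phi : R -> R) (s : R) :
  (forall t, Rabs (t - c) < h -> continuous phi t) -> Rabs (s - c) < h ->
  is_derive (primitive_from c p0 phi) s (phi s).
Proof.
  intros cont hs; unfold primitive_from.
  replace (phi s) with (0 + phi s) by ring.
  apply (is_derive_plus (fun _ => p0) (fun t => RInt phi c t)).
  - apply (@is_derive_const R_AbsRing R_NormedModule).
  - apply (is_derive_RInt phi _ c s); [|apply cont, hs].
    generalize (ball_open c h s hs); apply filter_imp; intros t ht.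
    apply (@RInt_correct R_CompleteNormedModule), ex_RInt_continuous.
    intros z hz; apply cont.
    eapply Rle_lt_trans; [apply between_shrink, hz | exact ht].
Qed.

Lemma primitive_from_derive_global (c p0 : R) (phi : R -> R) (s : R) :
  (forall t, continuous phi t) -> is_derive (primitive_from c p0 phi) s (phi s).
Proof.
  intros cont; apply primitive_from_derive with (Rabs (s - c) + 1); [|lra].
  intros; apply cont.
Qed.

Fixpoint picard (f g : R -> R -> R) (c p0 q0 : R) (n : nat)
    : (R -> R) * (R -> R) :=
  match n with
  | O => (fun _ => p0, fun _ => q0)
  | S n =>
    let '(p, q) := picard f g c p0 q0 n in
    (primitive_from c p0 (fun t => f (p t) (q t)),
     primitive_from c q0 (fun t => g (p t) (q t)))
  end.

(** On [|s - c| < h] the iterates converge geometrically and their derivatives converge uniformly,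
    which lets the differential equations themselves pass to the limit. *)
Theorem local_existence (f g : R -> R -> R) (L c p0 q0 : R) :
  0 < L -> lipschitz2 L f -> lipschitz2 L g ->
  exists (h : R) (p q : R -> R), 0 < h /\ p c = p0 /\ q c = q0 /\
    forall s, Rabs (s - c) < h ->
      is_derive p s (f (p s) (q s)) /\ is_derive q s (g (p s) (q s)).
Proof.
  intros L0 lf lg.
  set (P n := fst (picard f g c p0 q0 n)); set (Q n := snd (picard f g c p0 q0 n)).
  assert (PS : forall n, P (S n) = primitive_from c p0 (fun t => f (P n t) (Q n t))).
  { intros n; unfold P, Q; simpl; destruct (picard f g c p0 q0 n); reflexivity. }
  assert (QS : forall n, Q (S n) = primitive_from c q0 (fun t => g (P n t) (Q n t))).
  { intros n; unfold P, Q; simpl; destruct (picard f g c p0 q0 n); reflexivity. }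
  assert (cont : forall n s, continuous (P n) s /\ continuous (Q n) s).
  { induction n as [|n IH]; intros s.
    - split; apply continuous_const.
    - rewrite PS, QS; split.
      + apply (ex_derive_continuous (primitive_from c p0 _)).
        eexists; apply primitive_from_derive_global.
        intros t; apply lipschitz2_continuous with L; try assumption; apply IH.
      + apply (ex_derive_continuous (primitive_from c q0 _)).
        eexists; apply primitive_from_derive_global.
        intros t; apply lipschitz2_continuous with L; try assumption; apply IH. }
  assert (contf : forall n s, continuous (fun t => f (P n t) (Q n t)) s).
  { intros n s; apply lipschitz2_continuous with L; try assumption; apply cont. }
  assert (contg : forall n s, continuous (fun t => g (P n t) (Q n t)) s).
  { intros n s; apply lipschitz2_continuous with L; try assumption; apply cont. }
  assert (dP : forall n s, is_derive (P (S n)) s (f (P n s) (Q n s))).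
  { intros n s; rewrite PS.
    apply (primitive_from_derive_global c p0 (fun t => f (P n t) (Q n t))), contf. }
  assert (dQ : forall n s, is_derive (Q (S n)) s (g (P n s) (Q n s))).
  { intros n s; rewrite QS.
    apply (primitive_from_derive_global c q0 (fun t => g (P n t) (Q n t))), contg. }
  assert (Pc : forall n, P n c = p0).
  { intros [|n]; [reflexivity | rewrite PS; apply primitive_from_start]. }
  assert (Qc : forall n, Q n c = q0).
  { intros [|n]; [reflexivity | rewrite QS; apply primitive_from_start]. }
  (* A Picard step changes each component by at most [L * 2 * (K / 2 ^ n) * h], where 2 counts the
     components; this [h] halves the increment. *)
  set (h := / (4 * L)).
  assert (h0 : 0 < h) by (apply Rinv_0_lt_compat; lra).
  (* [K] bounds both components of the first increment, whose derivatives are the constants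
     [f p0 q0] and [g p0 q0]. *)
  set (K := h * (Rabs (f p0 q0) + Rabs (g p0 q0))).
  assert (inc : forall n s, Rabs (s - c) < h ->
    Rabs (P (S n) s - P n s) <= K / 2 ^ n /\
    Rabs (Q (S n) s - Q n s) <= K / 2 ^ n).
  { induction n as [|n IH]; intros s hs.
    - assert (bP : Rabs (P 1%nat s - P 1%nat c) <= Rabs (f p0 q0) * Rabs (s - c)).
      { apply derive_bound_increment with (fun t => f (P 0%nat t) (Q 0%nat t)).
        - intros; apply dP.
        - intros; apply Rle_refl. }
      assert (bQ : Rabs (Q 1%nat s - Q 1%nat c) <= Rabs (g p0 q0) * Rabs (s - c)).
      { apply derive_bound_increment with (fun t => g (P 0%nat t) (Q 0%nat t)).
        - intros; apply dQ.
        - intros; apply Rle_refl. }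
      rewrite Pc in bP; rewrite Qc in bQ.
      generalize (Rabs_pos (f p0 q0)) (Rabs_pos (g p0 q0)) (Rabs_pos (s - c)).
      change (P 0%nat s) with p0; change (Q 0%nat s) with q0.
      unfold K; simpl; split; nra.
    - assert (near : forall t, Rmin c s <= t <= Rmax c s ->
        L * (Rabs (P (S n) t - P n t) + Rabs (Q (S n) t - Q n t))
          <= 2 * L * (K / 2 ^ n)).
      { intros t ht; destruct (IH t).
        - eapply Rle_lt_trans; [apply between_shrink, ht | exact hs].
        - nra. }
      assert (step : 2 * L * (K / 2 ^ n) * Rabs (s - c) <= K / 2 ^ S n).
      { replace (K / 2 ^ S n) with (2 * L * (K / 2 ^ n) * h).
        2:{ unfold h; simpl; field; split; [apply pow_nonzero; lra | lra]. }
        apply Rmult_le_compat_l; [|lra].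
        generalize (Rabs_pos (f p0 q0)) (Rabs_pos (g p0 q0)); intros.
        assert (0 <= K) by (unfold K; nra).
        assert (0 < / 2 ^ n) by (apply Rinv_0_lt_compat, pow_lt; lra).
        unfold Rdiv; assert (0 <= K * / 2 ^ n) by nra; nra. }
      split; eapply Rle_trans; [|apply step| |apply step].
      + replace (P (S (S n)) s - P (S n) s)
          with ((P (S (S n)) s - P (S n) s) - (P (S (S n)) c - P (S n) c))
          by (rewrite !Pc; ring).
        apply (derive_bound_increment (fun t => P (S (S n)) t - P (S n) t)
          (fun t => f (P (S n) t) (Q (S n) t) - f (P n t) (Q n t))).
        * intros t _; apply (is_derive_minus (P (S (S n))) (P (S n))); apply dP.
        * intros t ht; eapply Rle_trans; [apply lf | apply near, ht].
      + replace (Q (S (S n)) s - Q (S n) s)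
          with ((Q (S (S n)) s - Q (S n) s) - (Q (S (S n)) c - Q (S n) c))
          by (rewrite !Qc; ring).
        apply (derive_bound_increment (fun t => Q (S (S n)) t - Q (S n) t)
          (fun t => g (P (S n) t) (Q (S n) t) - g (P n t) (Q n t))).
        * intros t _; apply (is_derive_minus (Q (S (S n))) (Q (S n))); apply dQ.
        * intros t ht; eapply Rle_trans; [apply lg | apply near, ht]. }
  set (p s := real (Lim_seq (fun n => P n s))).
  set (q s := real (Lim_seq (fun n => Q n s))).
  assert (limP : forall s, Rabs (s - c) < h -> Un_cv (fun n => P n s) (p s) /\
    forall n, Rabs (p s - P n s) <= 2 * K / 2 ^ n).
  { intros s hs; apply (geometric_increments_limit (fun n => P n s) K).
    intros n; apply inc, hs. }
  assert (limQ : forall s, Rabs (s - c) < h -> Un_cv (fun n => Q n s) (q s) /\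
    forall n, Rabs (q s - Q n s) <= 2 * K / 2 ^ n).
  { intros s hs; apply (geometric_increments_limit (fun n => Q n s) K).
    intros n; apply inc, hs. }
  (* The constant [4 L K] is [L] times the sum of the two tail bounds [2 K]. *)
  assert (cvu : forall F, lipschitz2 L F ->
    CVU (fun n t => F (P n t) (Q n t)) (fun t => F (p t) (q t)) c (mkposreal h h0)).
  { intros F lF eps e0.
    destruct (half_pow_small (4 * L * K) eps e0) as [N hN].
    exists N; intros n t hn ht; unfold Boule in ht; simpl in ht.
    eapply Rle_lt_trans; [apply lF|].
    eapply Rle_lt_trans; [|apply (hN n hn)].
    replace (4 * L * K / 2 ^ n) with (L * (2 * K / 2 ^ n + 2 * K / 2 ^ n))
      by (field; apply pow_nonzero; lra).
    apply Rmult_le_compat_l; [lra|].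
    apply Rplus_le_compat; [apply limP | apply limQ]; exact ht. }
  assert (lim_derive : forall F (U : nat -> R -> R) (u : R -> R), lipschitz2 L F ->
    (forall n s, is_derive (U (S n)) s (F (P n s) (Q n s))) ->
    (forall s, Rabs (s - c) < h -> Un_cv (fun n => U n s) (u s)) ->
    forall s, Rabs (s - c) < h -> is_derive u s (F (p s) (q s))).
  { intros F U u lF dU lU s hs; apply is_derive_Reals.
    (* The sequence is shifted by one, because the derivative of an iterate is expressed through its
       predecessor. *)
    apply (derivable_pt_lim_CVU (fun n => U (S n)) (fun n t => F (P n t) (Q n t))
             u (fun t => F (p t) (q t)) s c (mkposreal h h0)).
    - exact hs.
    - intros t n _; apply is_derive_Reals, dU.
    - intros t ht eps e0; destruct (lU t ht eps e0) as [N hN].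
      exists N; intros n hn; apply hN; lia.
    - apply cvu, lF.
    - intros t ht.
      apply (CVU_continuity (fun n t => F (P n t) (Q n t)) (fun t => F (p t) (q t))
               c (mkposreal h h0)); [apply cvu, lF| |exact ht].
      intros n y _; apply continuity_pt_filterlim.
      apply lipschitz2_continuous with L; try assumption; apply cont. }
  exists h, p, q; split; [exact h0|]; split; [|split; [|intros s hs; split]].
  - unfold p; rewrite (Lim_seq_ext _ (fun _ => p0)) by apply Pc.
    rewrite Lim_seq_const; reflexivity.
  - unfold q; rewrite (Lim_seq_ext _ (fun _ => q0)) by apply Qc.
    rewrite Lim_seq_const; reflexivity.
  - apply (lim_derive f P); try assumption; intros t ht; apply limP, ht.
  - apply (lim_derive g Q); try assumption; intros t ht; apply limQ, ht.
Qed.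

(** * Continuation through a regular limit point *)

Lemma abs_sub_sin_le (a b : R) : Rabs (sin a - sin b) <= Rabs (a - b).
Proof.
  rewrite <- (Rmult_1_l (Rabs (a - b))).
  apply (derive_bound_increment sin cos).
  - intros s _; apply is_derive_Reals, derivable_pt_lim_sin.
  - intros s _; apply Rabs_le, COS_bound.
Qed.

Lemma abs_sub_cos_le (a b : R) : Rabs (cos a - cos b) <= Rabs (a - b).
Proof.
  rewrite <- (Rmult_1_l (Rabs (a - b))).
  apply (derive_bound_increment cos (fun s => - sin s)).
  - intros s _; apply is_derive_Reals, derivable_pt_lim_cos.
  - intros s _; rewrite Rabs_Ropp; apply Rabs_le, SIN_bound.
Qed.

Lemma inv_Rmax_bounds (d a : R) : 0 < d -> 0 < / Rmax a d <= / d.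
Proof.
  intros d0; assert (d <= Rmax a d) by apply Rmax_r.
  split; [apply Rinv_0_lt_compat | apply Rinv_le_contravar]; lra.
Qed.

Lemma abs_sub_inv_Rmax_le (d a b : R) : 0 < d ->
  Rabs (/ Rmax a d - / Rmax b d) <= / d * / d * Rabs (a - b).
Proof.
  intros d0.
  assert (ha := Rmax_r a d); assert (hb := Rmax_r b d).
  replace (/ Rmax a d - / Rmax b d)
    with (/ Rmax a d * / Rmax b d * (Rmax b d - Rmax a d)) by (field; lra).
  assert (ia := inv_Rmax_bounds d a d0); assert (ib := inv_Rmax_bounds d b d0).
  rewrite Rabs_mult, (Rabs_pos_eq (/ _ * / _)) by nra.
  apply Rmult_le_compat; [nra | apply Rabs_pos | |].
  - apply Rmult_le_compat; lra.
  - clear; unfold Rmax; destruct (Rle_dec a d), (Rle_dec b d);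
      unfold Rabs; repeat destruct Rcase_abs; lra.
Qed.

(** Both denominators are cut off from below at [d]: the result agrees with [theta'] where [y] and
    [sin t] are at least [d], and it is globally Lipschitz. *)
Definition truncated_angular_speed (d y t : R) : R :=
  / Rmax (sin t) d - cos t * / Rmax y d.

Lemma truncated_angular_speed_lipschitz (d : R) : 0 < d ->
  lipschitz2 (1 + / d + / d * / d) (truncated_angular_speed d).
Proof.
  intros d0 y t y' t'; unfold truncated_angular_speed.
  assert (i0 : 0 < / d) by (apply Rinv_0_lt_compat, d0).
  assert (i1 := abs_sub_inv_Rmax_le d (sin t) (sin t') d0).
  assert (i2 := abs_sub_inv_Rmax_le d y y' d0).
  assert (i3 := abs_sub_sin_le t t'); assert (i4 := abs_sub_cos_le t t').
  assert (i5 := inv_Rmax_bounds d y' d0).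
  assert (i6 : Rabs (cos t) <= 1) by apply Rabs_le, COS_bound.
  set (A := / Rmax (sin t) d) in *; set (A' := / Rmax (sin t') d) in *.
  set (B := / Rmax y d) in *; set (B' := / Rmax y' d) in *.
  replace (A - cos t * B - (A' - cos t' * B'))
    with ((A - A') + - (cos t * (B - B') + (cos t - cos t') * B')) by ring.
  eapply Rle_trans; [apply Rabs_triang|]; rewrite Rabs_Ropp.
  assert (i7 := Rabs_triang (cos t * (B - B')) ((cos t - cos t') * B')).
  rewrite !Rabs_mult, (Rabs_pos_eq B') in i7 by lra.
  assert (p1 := Rabs_pos (y - y')); assert (p2 := Rabs_pos (t - t')).
  assert (p3 := Rabs_pos (B - B')); assert (p4 := Rabs_pos (cos t - cos t')).
  assert (Rabs (cos t) * Rabs (B - B') <= / d * / d * Rabs (y - y')) by nra.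
  assert (Rabs (cos t - cos t') * B' <= Rabs (t - t') * / d).
  { apply Rmult_le_compat; lra. }
  assert (/ d * / d * Rabs (sin t - sin t') <= / d * / d * Rabs (t - t')).
  { apply Rmult_le_compat_l; nra. }
  assert (0 < / d * / d) by nra.
  nra.
Qed.

Lemma sin_lipschitz2 (L : R) : 1 <= L -> lipschitz2 L (fun _ t => sin t).
Proof.
  intros L1 y t y' t'.
  generalize (abs_sub_sin_le t t') (Rabs_pos (y - y')) (Rabs_pos (t - t')); nra.
Qed.

(** The conditions of [solution] at a single time, without interval or initial data, so that they
    can be checked piecewise on glued functions. *)
Definition flow_at (x y theta : R -> R) (s : R) : Prop :=
  0 < y s /\ 0 < theta s < PI /\
  is_derive x s (cos (theta s)) /\
  is_derive y s (sin (theta s)) /\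
  is_derive theta s (1 / sin (theta s) - cos (theta s) / y s).

Lemma flow_at_ext (x y theta u v w : R -> R) (s : R) :
  locally s (fun t => u t = x t /\ v t = y t /\ w t = theta t) ->
  flow_at x y theta s -> flow_at u v w s.
Proof.
  intros ext [hy [ht [dx [dy dt]]]].
  destruct (locally_singleton _ _ ext) as [eu [ev ew]].
  unfold flow_at; rewrite ev, ew; split; [exact hy|]; split; [exact ht|].
  split; [|split].
  - apply (is_derive_ext_loc x); [|exact dx].
    revert ext; apply filter_imp; intros t [e _]; symmetry; exact e.
  - apply (is_derive_ext_loc y); [|exact dy].
    revert ext; apply filter_imp; intros t [_ [e _]]; symmetry; exact e.
  - apply (is_derive_ext_loc theta); [|exact dt].
    revert ext; apply filter_imp; intros t [_ [_ e]]; symmetry; exact e.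
Qed.

Lemma is_derive_continuous (f : R -> R) (s l : R) : is_derive f s l -> continuous f s.
Proof. intros d; apply (ex_derive_continuous f); eexists; exact d. Qed.

Lemma continuous_eventually_between (f : R -> R) (s a b : R) :
  continuous f s -> a < f s < b -> locally s (fun t => a < f t < b).
Proof.
  intros cf [h1 h2]; apply (cf (fun z => a < z < b)).
  apply filter_and; [apply (open_gt a) | apply (open_lt b)]; assumption.
Qed.

(** The truncated system is solved through [(y1, t1)]; by continuity the solution stays above the
    cut-off for a short time, and there it solves the true system. *)
Lemma local_flow (c y1 t1 : R) : 0 < y1 -> 0 < t1 < PI ->
  exists (h : R) (y theta : R -> R), 0 < h /\ y c = y1 /\ theta c = t1 /\
    forall s, Rabs (s - c) < h ->
      0 < y s /\ 0 < theta s < PI /\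
      is_derive y s (sin (theta s)) /\
      is_derive theta s (1 / sin (theta s) - cos (theta s) / y s).
Proof.
  intros y10 t1r.
  assert (s0 : 0 < sin t1) by (apply sin_gt_0; lra).
  (* Half the minimum, so that both starting values lie strictly above the cut-off. *)
  set (d := Rmin y1 (sin t1) / 2).
  assert (d0 : 0 < d).
  { unfold d; generalize (Rmin_glb_lt _ _ _ y10 s0); lra. }
  assert (dy : d < y1).
  { unfold d in *; generalize (Rmin_l y1 (sin t1)); lra. }
  assert (ds : d < sin t1).
  { unfold d in *; generalize (Rmin_r y1 (sin t1)); lra. }
  assert (i0 : 0 < / d) by (apply Rinv_0_lt_compat, d0).
  destruct (local_existence (fun _ t => sin t) (truncated_angular_speed d)
              (1 + / d + / d * / d) c y1 t1) as [h [y [theta [h0 [yc [tc dv]]]]]].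
  - nra.
  - apply sin_lipschitz2; nra.
  - apply truncated_angular_speed_lipschitz, d0.
  - destruct (dv c) as [dyc dtc]; [rewrite Rminus_diag, Rabs_R0; exact h0|].
    apply is_derive_continuous in dyc, dtc.
    assert (ev : locally c (fun s => d < y s < y1 + 1 /\ 0 < theta s < PI /\
                                     d < sin (theta s) < 2)).
    { apply filter_and; [|apply filter_and].
      - apply continuous_eventually_between; [exact dyc | lra].
      - apply continuous_eventually_between; [exact dtc | lra].
      - apply (continuous_eventually_between (fun s => sin (theta s))).
        + apply (continuous_comp theta sin); [exact dtc | apply continuous_sin].
        + rewrite tc; generalize (SIN_bound t1); lra. }
    destruct ev as [r hr].
    exists (Rmin h r), y, theta; split; [|split; [exact yc | split; [exact tc|]]].
    + apply Rmin_glb_lt; [exact h0 | apply cond_pos].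
    + intros s hs.
      destruct (hr s) as [hy [ht hsin]].
      { change (Rabs (s - c) < r).
        eapply Rlt_le_trans; [exact hs | apply Rmin_r]. }
      destruct (dv s) as [dys dts].
      { eapply Rlt_le_trans; [exact hs | apply Rmin_l]. }
      split; [lra|]; split; [lra|]; split; [exact dys|].
      unfold truncated_angular_speed in dts.
      rewrite (Rmax_left (sin (theta s))), (Rmax_left (y s)) in dts by lra.
      unfold Rdiv; rewrite Rmult_1_l; exact dts.
Qed.

(** By the mean value theorem a difference quotient at [c] is a value of [df] at a point near [c],
    and [df] is continuous there. This supplies the derivative at a gluing point. *)
Lemma is_derive_of_punctured (f df : R -> R) (c h : R) : 0 < h ->
  (forall s, 0 < Rabs (s - c) < h -> is_derive f s (df s)) ->
  continuous f c -> continuous df c -> is_derive f c (df c).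
Proof.
  intros h0 dv cf cdf; apply is_derive_Reals; intros eps e0.
  destruct (proj1 (filterlim_locally df (df c)) cdf (mkposreal eps e0)) as [r hr].
  assert (m0 : 0 < Rmin h r) by (apply Rmin_glb_lt; [exact h0 | apply cond_pos]).
  exists (mkposreal _ m0); intros k k0 hk; simpl in hk.
  assert (kh : Rabs k < h) by (eapply Rlt_le_trans; [exact hk | apply Rmin_l]).
  assert (kr : Rabs k < r) by (eapply Rlt_le_trans; [exact hk | apply Rmin_r]).
  assert (inside : forall s, Rmin c (c + k) <= s <= Rmax c (c + k) ->
    Rabs (s - c) <= Rabs k).
  { intros s hs; apply between_shrink in hs.
    replace (c + k - c) with k in hs by ring; exact hs. }
  destruct (MVT_gen f c (c + k) df) as [z [hz e]].
  - intros s hs; apply dv; split.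
    + apply Rabs_pos_lt; unfold Rmin, Rmax in hs; destruct Rle_dec; lra.
    + eapply Rle_lt_trans; [apply inside; lra | exact kh].
  - intros s hs; apply continuity_pt_filterlim.
    destruct (Req_dec s c) as [->|ne]; [exact cf|].
    apply is_derive_continuous with (df s), dv; split.
    + apply Rabs_pos_lt; lra.
    + eapply Rle_lt_trans; [apply inside, hs | exact kh].
  - replace ((f (c + k) - f c) / k) with (df z) by (rewrite e; field; exact k0).
    apply (hr z); change (Rabs (z - c) < r).
    eapply Rle_lt_trans; [apply inside, hz | exact kr].
Qed.

(** * One-sided neighbourhoods and gluing *)

Definition side (left : bool) (c s : R) : Prop := if left then s < c else c < s.

Definition side_dec (left : bool) (c s : R) : {side left c s} + {~ side left c s} :=
  if left as b return {side b c s} + {~ side b c s}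
  then Rlt_dec s c else Rlt_dec c s.

(** The Boolean lets one gluing argument serve both ends of the interval. *)
Definition at_side (left : bool) (c : R) : (R -> Prop) -> Prop :=
  within (side left c) (locally c).

#[local] Instance at_side_proper (left : bool) (c : R) : ProperFilter (at_side left c).
Proof.
  destruct left; [apply at_left_proper_filter | apply at_right_proper_filter].
Qed.

Lemma side_open (left : bool) (c s : R) : side left c s -> locally s (side left c).
Proof. destruct left; [apply (open_lt c) | apply (open_gt c)]. Qed.

Lemma side_ne (left : bool) (c s : R) : side left c s -> s <> c.
Proof. destruct left; simpl; lra. Qed.

Lemma side_between (left : bool) (c s t z : R) : side left c s -> side left c t ->
  Rmin s t <= z <= Rmax s t -> side left c z.
Proof.
  destruct left; simpl; unfold Rmin, Rmax; destruct Rle_dec; lra.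
Qed.

Definition glue (left : bool) (c : R) (a b : R -> R) (s : R) : R :=
  if side_dec left c s then a s else b s.

Lemma glue_in (left : bool) (c : R) (a b : R -> R) (s : R) :
  side left c s -> glue left c a b s = a s.
Proof. intros h; unfold glue; destruct side_dec; tauto. Qed.

Lemma glue_out (left : bool) (c : R) (a b : R -> R) (s : R) :
  ~ side left c s -> glue left c a b s = b s.
Proof. intros h; unfold glue; destruct side_dec; tauto. Qed.

Lemma glue_continuous (left : bool) (c : R) (a b : R -> R) :
  filterlim a (at_side left c) (locally (b c)) -> continuous b c ->
  continuous (glue left c a b) c.
Proof.
  intros la cb; apply filterlim_locally; intros eps.
  assert (ca := proj1 (filterlim_locally a (b c)) la eps).
  assert (cb' := proj1 (filterlim_locally b (b c)) cb eps).
  rewrite (glue_out left c a b c) by (intros h; apply side_ne in h; tauto).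
  unfold at_side, within in ca.
  generalize (filter_and _ _ ca cb'); apply filter_imp; intros s [h1 h2].
  unfold glue; destruct side_dec; [apply h1|]; assumption.
Qed.

(* The two halves satisfy the system away from [c]; at [c] the glued functions
   are continuous, so their derivatives have the right limit there. *)
Lemma flow_extends_through (left : bool) (c r l m : R) (x y theta : R -> R) :
  0 < r ->
  (forall s, side left c s -> Rabs (s - c) < r -> flow_at x y theta s) ->
  filterlim y (at_side left c) (locally l) ->
  filterlim theta (at_side left c) (locally m) ->
  0 < l -> 0 < m < PI ->
  exists (h : R) (u v w : R -> R), 0 < h /\
    (forall s, side left c s -> u s = x s /\ v s = y s /\ w s = theta s) /\
    forall s, Rabs (s - c) < h -> flow_at u v w s.
Proof.
  intros r0 fl ly lt l0 mr.
  (* The derivative of [x] is a cosine, so [x] is 1-Lipschitz and has a one-sided limit by the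
     Cauchy criterion. *)
  assert (lx : exists k, filterlim x (at_side left c) (locally k)).
  { apply (proj1 (filterlim_locally_cauchy (F := at_side left c) x)).
    intros eps.
    assert (m0 : 0 < Rmin r (eps / 2)).
    { apply Rmin_glb_lt; [exact r0 | generalize (cond_pos eps); lra]. }
    exists (fun s => side left c s /\ Rabs (s - c) < Rmin r (eps / 2)); split.
    - exists (mkposreal _ m0); intros s hs sd; split; assumption.
    - intros s t [ss hs] [st ht].
      assert (far : Rabs (t - s) < eps).
      { replace (t - s) with ((t - c) + - (s - c)) by ring.
        eapply Rle_lt_trans; [apply Rabs_triang|]; rewrite Rabs_Ropp.
        generalize (Rmin_r r (eps / 2)); lra. }
      change (Rabs (x t - x s) < eps).
      eapply Rle_lt_trans; [|exact far].
      rewrite <- (Rmult_1_l (Rabs (t - s))).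
      apply derive_bound_increment with (fun z => cos (theta z)).
      + intros z hz; apply fl; [apply (side_between _ _ _ _ _ ss st hz)|].
        apply Rabs_def2 in hs, ht; apply Rabs_def1;
          generalize (Rmin_l r (eps / 2)); unfold Rmin, Rmax in hz;
          destruct Rle_dec in hz; unfold Rmin in *; destruct Rle_dec; lra.
      + intros z _; apply Rabs_le, COS_bound. }
  destruct lx as [k lx].
  (* The continuation starts at [c] from the one-sided limits; its abscissa [o] is the primitive of
     [cos q] starting at [k]. *)
  destruct (local_flow c l m l0 mr) as [h [p [q [h0 [pc [qc dv]]]]]].
  assert (cc : Rabs (c - c) < h) by (rewrite Rminus_diag, Rabs_R0; exact h0).
  destruct (dv c cc) as [_ [_ [dpc dqc]]].
  assert (contq : forall s, Rabs (s - c) < h -> continuous q s).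
  { intros s hs; eapply is_derive_continuous, dv, hs. }
  set (o := primitive_from c k (fun t => cos (q t))).
  assert (oc : o c = k) by apply primitive_from_start.
  assert (contcos : forall s, Rabs (s - c) < h -> continuous (fun t => cos (q t)) s).
  { intros s hs; apply (continuous_comp q cos);
      [apply contq, hs | apply continuous_cos]. }
  assert (deriv_o : forall s, Rabs (s - c) < h -> is_derive o s (cos (q s))).
  { intros s hs; apply (primitive_from_derive c h k (fun t => cos (q t))); assumption. }
  set (u := glue left c x o); set (v := glue left c y p); set (w := glue left c theta q).
  assert (nc : ~ side left c c) by (intros hc; apply side_ne in hc; tauto).
  assert (agree : forall s, side left c s -> u s = x s /\ v s = y s /\ w s = theta s).
  { intros s hs; unfold u, v, w; rewrite !glue_in by exact hs; tauto. }
  (* Away from [c] the glued functions coincide, on a whole neighbourhood, with one of the two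
     solutions. *)
  assert (off : forall s, 0 < Rabs (s - c) < Rmin h r -> flow_at u v w s).
  { intros s [hs1 hs2].
    assert (hsh : Rabs (s - c) < h) by (eapply Rlt_le_trans; [exact hs2 | apply Rmin_l]).
    assert (hsr : Rabs (s - c) < r) by (eapply Rlt_le_trans; [exact hs2 | apply Rmin_r]).
    destruct (side_dec left c s) as [sd|nsd].
    - apply flow_at_ext with x y theta; [|apply fl; assumption].
      generalize (side_open _ _ _ sd); apply filter_imp; exact agree.
    - apply flow_at_ext with o p q.
      + assert (ns : s <> c).
        { intros ->; rewrite Rminus_diag, Rabs_R0 in hs1; lra. }
        assert (os : side (negb left) c s) by (destruct left; simpl in *; lra).
        generalize (side_open _ _ _ os); apply filter_imp; intros t ht.
        unfold u, v, w; rewrite !glue_out by (destruct left; simpl in *; lra); tauto.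
      + destruct (dv s hsh) as [h1 [h2 [h3 h4]]].
        exact (conj h1 (conj h2 (conj (deriv_o s hsh) (conj h3 h4)))). }
  assert (uc : continuous u c).
  { apply glue_continuous; [rewrite oc; exact lx|].
    apply is_derive_continuous with (cos (q c)), deriv_o, cc. }
  assert (vc : continuous v c).
  { apply glue_continuous; [rewrite pc; exact ly|].
    eapply is_derive_continuous, dpc. }
  assert (wc : continuous w c).
  { apply glue_continuous; [rewrite qc; exact lt|].
    eapply is_derive_continuous, dqc. }
  assert (vcl : v c = l) by (unfold v; rewrite glue_out; assumption).
  assert (wcm : w c = m) by (unfold w; rewrite glue_out; assumption).
  assert (sm0 : 0 < sin m) by (apply sin_gt_0; lra).
  assert (sinc : continuous (fun s => sin (w s)) c).
  { apply (continuous_comp w sin); [exact wc | apply continuous_sin]. }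
  assert (cosc : continuous (fun s => cos (w s)) c).
  { apply (continuous_comp w cos); [exact wc | apply continuous_cos]. }
  assert (hr0 : 0 < Rmin h r) by (apply Rmin_glb_lt; assumption).
  exists (Rmin h r), u, v, w; split; [exact hr0|]; split; [exact agree|].
  intros s hs.
  destruct (Req_dec s c) as [->|ne].
  - split; [lra|]; split; [lra|]; split; [|split].
    + apply (is_derive_of_punctured u (fun s => cos (w s)) c _ hr0); try assumption.
      intros t ht; apply off, ht.
    + apply (is_derive_of_punctured v (fun s => sin (w s)) c _ hr0); try assumption.
      intros t ht; apply off, ht.
    + apply (is_derive_of_punctured w (fun s => 1 / sin (w s) - cos (w s) / v s)
               c _ hr0); try assumption.
      * intros t ht; apply off, ht.
      * apply (continuous_minus (fun s => 1 / sin (w s)) (fun s => cos (w s) / v s)).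
        -- apply (continuous_mult (K := R_AbsRing) (fun _ => 1) (fun s => / sin (w s))).
           ++ apply continuous_const.
           ++ apply (continuous_comp (fun s => sin (w s)) Rinv); [exact sinc|].
              apply continuous_Rinv; rewrite wcm; lra.
        -- apply (continuous_mult (K := R_AbsRing) (fun s => cos (w s)) (fun s => / v s)).
           ++ exact cosc.
           ++ apply (continuous_comp v Rinv); [exact vc|].
              apply continuous_Rinv; lra.
  - apply off; split; [apply Rabs_pos_lt; lra | exact hs].
Qed.

Lemma solution_flow_at (y0 : R) (sm sM : Rbar) (x y theta : R -> R) (s : R) :
  solution y0 sm sM x y theta -> in_itv sm sM s -> flow_at x y theta s.
Proof. intros [] hs; unfold flow_at; auto 10. Qed.

(** A limit inside the phase space would allow continuation up to [c + h], which maximality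
    forbids. *)
Lemma no_regular_limit_right (y0 c l m : R) (sm : Rbar) (x y theta : R -> R) :
  maximal_solution y0 sm c x y theta -> 0 < l -> 0 < m < PI ->
  filterlim y (at_left c) (locally l) ->
  filterlim theta (at_left c) (locally m) -> False.
Proof.
  intros [sol mx] l0 mr ly lt.
  assert (c0 := sol_right _ _ _ _ _ _ sol); assert (s0 := sol_left _ _ _ _ _ _ sol).
  simpl in c0.
  assert (inside : forall s, 0 <= s < c -> in_itv sm c s).
  { intros s hs; split; [eapply Rbar_lt_le_trans; [exact s0|]|]; simpl; lra. }
  (* The radius is [c] itself: the times before [c] within that distance lie in [(0, c)], hence in
     the domain. *)
  destruct (flow_extends_through true c c l m x y theta c0) as
    [h [u [v [w [h0 [agree fl]]]]]]; try assumption.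
  { intros s hs hc; simpl in hs; apply Rabs_def2 in hc.
    eapply solution_flow_at; [exact sol | apply inside; lra]. }
  assert (flow : forall s, in_itv sm (c + h) s -> flow_at u v w s).
  { intros s [hs1 hs2]; simpl in hs2.
    destruct (Rlt_dec s c) as [lc|nlc].
    - apply flow_at_ext with x y theta.
      + generalize (open_lt c s lc); apply filter_imp; exact agree.
      + eapply solution_flow_at; [exact sol | split; [exact hs1 | exact lc]].
    - apply fl, Rabs_def1; lra. }
  destruct (agree 0 c0) as [e1 [e2 e3]].
  destruct (mx sm (c + h) u v w) as [_ e].
  - split; try (intros s hs; apply flow, hs).
    + exact s0.
    + simpl; lra.
    + rewrite e1; apply (sol_x0 _ _ _ _ _ _ sol).
    + rewrite e2; apply (sol_y0 _ _ _ _ _ _ sol).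
    + rewrite e3; apply (sol_theta0 _ _ _ _ _ _ sol).
  - apply Rbar_le_refl.
  - simpl; lra.
  - intros s [_ hs]; apply agree, hs.
  - injection e; lra.
Qed.

Lemma no_regular_limit_left (y0 c l m : R) (sM : Rbar) (x y theta : R -> R) :
  maximal_solution y0 c sM x y theta -> 0 < l -> 0 < m < PI ->
  filterlim y (at_right c) (locally l) ->
  filterlim theta (at_right c) (locally m) -> False.
Proof.
  intros [sol mx] l0 mr ly lt.
  assert (c0 := sol_left _ _ _ _ _ _ sol); assert (s0 := sol_right _ _ _ _ _ _ sol).
  simpl in c0.
  assert (inside : forall s, c < s <= 0 -> in_itv c sM s).
  { intros s hs; split; [simpl; lra|].
    eapply Rbar_le_lt_trans; [|exact s0]; simpl; lra. }
  assert (nc0 : 0 < - c) by lra.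
  destruct (flow_extends_through false c (- c) l m x y theta nc0) as
    [h [u [v [w [h0 [agree fl]]]]]]; try assumption.
  { intros s hs hc; simpl in hs; apply Rabs_def2 in hc.
    eapply solution_flow_at; [exact sol | apply inside; lra]. }
  assert (flow : forall s, in_itv (c - h) sM s -> flow_at u v w s).
  { intros s [hs1 hs2]; simpl in hs1.
    destruct (Rlt_dec c s) as [lc|nlc].
    - apply flow_at_ext with x y theta.
      + generalize (open_gt c s lc); apply filter_imp; exact agree.
      + eapply solution_flow_at; [exact sol | split; [exact lc | exact hs2]].
    - apply fl, Rabs_def1; lra. }
  destruct (agree 0 c0) as [e1 [e2 e3]].
  destruct (mx (c - h) sM u v w) as [e _].
  - split; try (intros s hs; apply flow, hs).
    + simpl; lra.
    + exact s0.
    + rewrite e1; apply (sol_x0 _ _ _ _ _ _ sol).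
    + rewrite e2; apply (sol_y0 _ _ _ _ _ _ sol).
    + rewrite e3; apply (sol_theta0 _ _ _ _ _ _ sol).
  - simpl; lra.
  - apply Rbar_le_refl.
  - intros s [hs _]; apply agree, hs.
  - injection e; lra.
Qed.

(** * Real functions on an open interval *)

Lemma in_itv_locally (a b : Rbar) (s : R) : in_itv a b s -> locally s (in_itv a b).
Proof.
  intros [h1 h2].
  apply filter_and;
    [exact (open_Rbar_gt' (Finite s) a h1) | exact (open_Rbar_lt' (Finite s) b h2)].
Qed.

Lemma in_itv_convex (a b : Rbar) (s t z : R) :
  in_itv a b s -> in_itv a b t -> s <= z <= t -> in_itv a b z.
Proof.
  intros [h1 h2] [h3 h4] hz; split.
  - eapply Rbar_lt_le_trans; [exact h1 | simpl; lra].
  - eapply Rbar_le_lt_trans; [|exact h4]; simpl; lra.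
Qed.

Lemma in_itv_between (a b : Rbar) (s : R) : in_itv a b s ->
  exists s1 s2, s1 < s < s2 /\ in_itv a b s1 /\ in_itv a b s2.
Proof.
  intros hs; destruct (in_itv_locally a b s hs) as [e he].
  assert (e0 := cond_pos e).
  exists (s - e / 2), (s + e / 2); split; [lra|].
  split; apply he.
  - change (Rabs (s - e / 2 - s) < e); apply Rabs_def1; lra.
  - change (Rabs (s + e / 2 - s) < e); apply Rabs_def1; lra.
Qed.

Lemma left_end_intro (a b : Rbar) (s1 : R) (P : R -> Prop) : in_itv a b s1 ->
  (forall s, in_itv a b s -> s < s1 -> P s) -> left_end a P.
Proof.
  intros h1 hP.
  assert (inside : forall s : R, Rbar_lt a s -> s < s1 -> P s).
  { intros s hs lt; apply hP; [split; [exact hs|] | exact lt].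
    apply Rbar_lt_trans with (Finite s1); [exact lt | apply h1]. }
  destruct h1 as [h1 _]; destruct a as [c| |]; simpl in h1.
  - generalize (open_lt s1 c h1); unfold left_end, within; simpl.
    apply filter_imp; auto.
  - contradiction.
  - exists s1; intros s hs hs'; apply inside; assumption.
Qed.

Lemma right_end_intro (a b : Rbar) (s1 : R) (P : R -> Prop) : in_itv a b s1 ->
  (forall s, in_itv a b s -> s1 < s -> P s) -> right_end b P.
Proof.
  intros h1 hP.
  assert (inside : forall s : R, Rbar_lt s b -> s1 < s -> P s).
  { intros s hs lt; apply hP; [split; [|exact hs] | exact lt].
    apply Rbar_lt_trans with (Finite s1); [apply h1 | exact lt]. }
  destruct h1 as [_ h1]; destruct b as [c| |]; simpl in h1.
  - generalize (open_gt s1 c h1); unfold right_end, within; simpl.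
    apply filter_imp; auto.
  - exists s1; intros s hs hs'; apply inside; assumption.
  - contradiction.
Qed.

#[local] Instance left_end_filter (a : Rbar) : Filter (left_end a).
Proof. apply within_filter, Rbar_locally_filter. Qed.

#[local] Instance right_end_filter (b : Rbar) : Filter (right_end b).
Proof. apply within_filter, Rbar_locally_filter. Qed.

(** The limit is the infimum of the values up to [s0]; completeness speaks of suprema, hence the
    negated values in the proof. *)
Lemma increasing_limit_left (a b : Rbar) (phi : R -> R) (B s0 : R) :
  in_itv a b s0 ->
  (forall s t, in_itv a b s -> s < t -> t <= s0 -> phi s <= phi t) ->
  (forall s, in_itv a b s -> B <= phi s) ->
  exists l, filterlim phi (left_end a) (locally l) /\ B <= l /\
    (forall s, in_itv a b s -> s <= s0 -> l <= phi s) /\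
    forall z, l < z -> exists s, in_itv a b s /\ s < s0 /\ phi s < z.
Proof.
  intros h0 mono low.
  destruct (completeness (fun z => exists s, in_itv a b s /\ s <= s0 /\ z = - phi s))
    as [l [ub least]].
  - exists (- B); intros z [s [hs [_ ->]]]; generalize (low s hs); lra.
  - exists (- phi s0), s0; split; [exact h0 | split; [lra | reflexivity]].
  - assert (below : forall s, in_itv a b s -> s <= s0 -> - l <= phi s).
    { intros s hs le; assert (- phi s <= l); [|lra].
      apply ub; exists s; auto. }
    assert (attained : forall z, - l < z -> exists s, in_itv a b s /\ s <= s0 /\ phi s < z).
    { intros z hz; apply NNPP; intros no.
      assert (l <= - z); [|lra].
      apply least; intros z' [s [hs [le ->]]].
      apply Ropp_le_contravar, Rnot_lt_le; intros lt; apply no; exists s; auto. }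
    exists (- l); split; [|split; [|split; [exact below|]]].
    + apply filterlim_locally; intros eps.
      destruct (attained (- l + eps)) as [s1 [h1 [le1 lt1]]].
      { generalize (cond_pos eps); lra. }
      apply (left_end_intro a b s1); [exact h1|].
      intros s hs lt; change (Rabs (phi s - - l) < eps).
      generalize (below s hs ltac:(lra)) (mono s s1 hs lt le1); intros.
      apply Rabs_def1; lra.
    + assert (l <= - B); [|lra].
      apply least; intros z [s [hs [_ ->]]]; generalize (low s hs); lra.
    + intros z hz; destruct (attained z hz) as [s [hs [le lt]]].
      destruct (in_itv_between a b s hs) as [s1 [_ [[lt1 _] [h1 _]]]].
      exists s1; split; [exact h1|]; split; [lra|].
      generalize (mono s1 s h1 lt1 le); lra.
Qed.

Lemma increasing_limit_right (a b : Rbar) (phi : R -> R) (B s0 : R) :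
  in_itv a b s0 ->
  (forall s t, in_itv a b t -> s < t -> s0 <= s -> phi s <= phi t) ->
  (forall s, in_itv a b s -> phi s <= B) ->
  exists l, filterlim phi (right_end b) (locally l) /\ l <= B /\
    (forall s, in_itv a b s -> s0 <= s -> phi s <= l) /\
    forall z, z < l -> exists s, in_itv a b s /\ s0 < s /\ z < phi s.
Proof.
  intros h0 mono up.
  destruct (completeness (fun z => exists s, in_itv a b s /\ s0 <= s /\ z = phi s))
    as [l [ub least]].
  - exists B; intros z [s [hs [_ ->]]]; apply up, hs.
  - exists (phi s0), s0; split; [exact h0 | split; [lra | reflexivity]].
  - assert (above : forall s, in_itv a b s -> s0 <= s -> phi s <= l).
    { intros s hs le; apply ub; exists s; auto. }
    assert (attained : forall z, z < l -> exists s, in_itv a b s /\ s0 <= s /\ z < phi s).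
    { intros z hz; apply NNPP; intros no.
      assert (l <= z); [|lra].
      apply least; intros z' [s [hs [le ->]]].
      apply Rnot_lt_le; intros lt; apply no; exists s; auto. }
    exists l; split; [|split; [|split; [exact above|]]].
    + apply filterlim_locally; intros eps.
      destruct (attained (l - eps)) as [s1 [h1 [le1 lt1]]].
      { generalize (cond_pos eps); lra. }
      apply (right_end_intro a b s1); [exact h1|].
      intros s hs lt; change (Rabs (phi s - l) < eps).
      generalize (above s hs ltac:(lra)) (mono s1 s hs lt le1); intros.
      apply Rabs_def1; lra.
    + apply least; intros z [s [hs [_ ->]]]; apply up, hs.
    + intros z hz; destruct (attained z hz) as [s [hs [le lt]]].
      destruct (in_itv_between a b s hs) as [_ [s1 [[_ lt1] [_ h1]]]].
      exists s1; split; [exact h1|]; split; [lra|].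
      generalize (mono s s1 h1 lt1 le); lra.
Qed.

Lemma nondecreasing_of_derive (f df : R -> R) (a b : R) : a <= b ->
  (forall s, a <= s <= b -> is_derive f s (df s)) ->
  (forall s, a <= s <= b -> 0 <= df s) -> f a <= f b.
Proof.
  intros ab dv pos.
  destruct (MVT_gen f a b df) as [c [hc e]];
    rewrite ?Rmin_left, ?Rmax_right in * by exact ab.
  - intros s hs; apply dv; lra.
  - intros s hs; apply continuity_pt_filterlim, is_derive_continuous with (df s), dv, hs.
  - assert (0 <= df c * (b - a)); [|lra].
    apply Rmult_le_pos; [apply pos, hc | lra].
Qed.

Lemma intermediate_value (f df : R -> R) (a b z : R) : a <= b ->
  (forall s, a <= s <= b -> is_derive f s (df s)) ->
  f a <= z <= f b -> exists s, a <= s <= b /\ f s = z.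
Proof.
  intros [ab| <-] dv hz; [|exists a; lra].
  destruct (f_interv_is_interv f a b z ab hz) as [s [hs e]].
  - intros s hs; apply continuity_pt_filterlim, is_derive_continuous with (df s), dv, hs.
  - exists s; auto.
Qed.

(** Suppose [f b < 0] and let [c] be the supremum of the times with [0 <= f]. Continuity excludes
    [f c < 0] and [f c > 0], and the positive slope excludes [f c = 0]. *)
Lemma positive_after (f df : R -> R) (a b : R) : a < b ->
  (forall s, a <= s <= b -> is_derive f s (df s)) ->
  (forall s, a <= s <= b -> f s = 0 -> 0 < df s) ->
  0 <= f a -> 0 < f b.
Proof.
  assert (slope : forall (g : R -> R) s l, is_derive g s l -> g s = 0 -> 0 < l ->
    exists d, 0 < d /\ forall k, 0 < k < d -> 0 < g (s + k) /\ g (s - k) < 0).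
  { intros g s l dv z l0; apply is_derive_Reals in dv.
    destruct (dv l l0) as [d hd]; exists d; split; [apply cond_pos|].
    intros k hk.
    assert (k1 := hd k ltac:(lra) ltac:(rewrite Rabs_pos_eq; lra)).
    assert (k2 := hd (- k) ltac:(lra) ltac:(rewrite Rabs_Ropp, Rabs_pos_eq; lra)).
    rewrite z in k1, k2; apply Rabs_def2 in k1, k2.
    assert (e1 : g (s + k) = (g (s + k) - 0) / k * k) by (field; lra).
    assert (e2 : g (s - k) = - ((g (s + - k) - 0) / - k * k)).
    { replace (s + - k) with (s - k) by ring; field; lra. }
    rewrite e1, e2; split; nra. }
  (* Quantified anew over [b], because the last step applies it to a shorter interval. *)
  assert (no_neg : forall b, a < b ->
    (forall s, a <= s <= b -> is_derive f s (df s)) ->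
    (forall s, a <= s <= b -> f s = 0 -> 0 < df s) -> 0 <= f a -> ~ f b < 0).
  { clear b; intros b ab dv up fa fb.
    destruct (completeness (fun s => a <= s <= b /\ 0 <= f s)) as [c [ub least]].
    - exists b; intros s hs; apply hs.
    - exists a; lra.
    - assert (hc : a <= c <= b).
      { split; [apply ub; lra | apply least; intros s hs; apply hs]. }
      assert (cont := is_derive_continuous _ _ _ (dv c hc)).
      assert (neg : forall s, c < s <= b -> f s < 0).
      { intros s hs; apply Rnot_le_lt; intros ge.
        assert (s <= c); [apply ub; lra | lra]. }
      destruct (Rtotal_order (f c) 0) as [lt|[z|gt]].
      + assert (ev := continuous_eventually_between f c (f c - 1) 0 cont ltac:(lra)).
        destruct ev as [e he].
        assert (c <= c - e / 2); [|generalize (cond_pos e); lra].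
        apply least; intros s [hs ge]; apply Rnot_lt_le; intros lt'.
        assert (s <= c) by (apply ub; auto).
        assert (f s < 0); [|lra].
        apply he; change (Rabs (s - c) < e).
        generalize (cond_pos e); intros; apply Rabs_def1; lra.
      + assert (cb : c < b).
        { destruct (proj2 hc) as [lt|e]; [exact lt | rewrite e in z; lra]. }
        destruct (slope f c (df c) (dv c hc) z (up c hc z)) as [d [d0 hd]].
        assert (m0 : 0 < Rmin d (b - c)) by (apply Rmin_glb_lt; lra).
        assert (f (c + Rmin d (b - c) / 2) < 0).
        { apply neg; generalize (Rmin_r d (b - c)); lra. }
        assert (0 < f (c + Rmin d (b - c) / 2)); [|lra].
        apply hd; generalize (Rmin_l d (b - c)); lra.
      + assert (cb : c < b).
        { destruct (proj2 hc) as [lt|e]; [exact lt | rewrite e in gt; lra]. }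
        assert (ev := continuous_eventually_between f c 0 (f c + 1) cont ltac:(lra)).
        destruct ev as [e he].
        assert (m0 : 0 < Rmin e (b - c)).
        { apply Rmin_glb_lt; [apply cond_pos | lra]. }
        assert (f (c + Rmin e (b - c) / 2) < 0).
        { apply neg; generalize (Rmin_r e (b - c)); lra. }
        assert (0 < f (c + Rmin e (b - c) / 2)); [|lra].
        apply he; change (Rabs (c + Rmin e (b - c) / 2 - c) < e).
        generalize (Rmin_l e (b - c)); intros; apply Rabs_def1; lra. }
  intros ab dv up fa.
  destruct (Rtotal_order (f b) 0) as [lt|[z|gt]]; [|exfalso|exact gt].
  - exfalso; exact (no_neg b ab dv up fa lt).
  (* If [f b = 0], the positive slope makes [f] negative just before [b], where [no_neg] excludes
     it. *)
  - destruct (slope f b (df b) (dv b ltac:(lra)) z (up b ltac:(lra) z)) as [d [d0 hd]].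
    assert (m0 : 0 < Rmin d (b - a)) by (apply Rmin_glb_lt; lra).
    generalize (Rmin_l d (b - a)) (Rmin_r d (b - a)); intros.
    destruct (hd (Rmin d (b - a) / 2) ltac:(lra)) as [_ neg].
    revert neg; apply no_neg; try assumption; [lra| |];
      intros s hs; [apply dv | apply up]; lra.
Qed.

(** A supremum defines [g] as a total function without choosing preimages; its derivative at a point
    comes from the inverse function theorem on a compact interval around it. *)
Lemma inverse_derivable (a b : Rbar) (phi dphi : R -> R) :
  (forall s, in_itv a b s -> is_derive phi s (dphi s)) ->
  (forall s, in_itv a b s -> 0 < dphi s) ->
  exists g : R -> R, forall s, in_itv a b s ->
    g (phi s) = s /\ is_derive g (phi s) (/ dphi s).
Proof.
  intros dv pos.
  assert (incr : forall s t, in_itv a b s -> in_itv a b t -> s < t -> phi s < phi t).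
  { intros s t [hs _] [_ ht] lt.
    apply (incr_function phi a b dphi); auto; intros z h1 h2;
      [apply dv | apply pos]; split; assumption. }
  set (g := fun t => real (Lub_Rbar (fun s => in_itv a b s /\ phi s <= t))).
  assert (inv : forall s, in_itv a b s -> g (phi s) = s).
  { intros s hs; unfold g.
    rewrite (is_lub_Rbar_unique _ (Finite s)); [reflexivity|]; split.
    - intros t [ht le]; simpl; apply Rnot_lt_le; intros lt.
      generalize (incr s t hs ht lt); lra.
    - intros u hu; apply hu; split; [exact hs | lra]. }
  exists g; intros s hs; split; [apply inv, hs|].
  destruct (in_itv_between a b s hs) as [s1 [s2 [[lt1 lt2] [h1 h2]]]].
  assert (inside : forall z, s1 <= z <= s2 -> in_itv a b z).
  { intros z hz; apply (in_itv_convex a b s1 s2); assumption. }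
  assert (cont : forall z, s1 <= z <= s2 -> continuity_pt phi z).
  { intros z hz; apply continuity_pt_filterlim, is_derive_continuous with (dphi z).
    apply dv, inside, hz. }
  assert (lt12 : s1 < s2) by lra.
  assert (cg : continuity_pt g (phi s)).
  { apply (continuity_pt_recip_prelim phi g s1 s2 lt12).
    - intros z t hz zt ht; apply incr; try apply inside; lra.
    - intros z hz; apply inv, inside, hz.
    - exact cont.
    - split; apply incr; assumption. }
  assert (Prf : forall z, g (phi s1) <= z <= g (phi s2) -> derivable_pt phi z).
  { intros z hz; exists (dphi z); apply is_derive_Reals, dv, inside.
    rewrite !inv in hz by assumption; exact hz. }
  assert (hg : g (phi s1) <= g (phi s) <= g (phi s2)) by (rewrite !inv by assumption; lra).
  assert (val : derive_pt phi (g (phi s)) (Prf (g (phi s)) hg) = dphi s).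
  { apply derive_pt_eq_0; rewrite inv by assumption; apply is_derive_Reals, dv, hs. }
  apply is_derive_Reals.
  replace (/ dphi s) with (1 / derive_pt phi (g (phi s)) (Prf (g (phi s)) hg)).
  - apply (derivable_pt_lim_recip_interv phi g (phi s1) (phi s2)).
    + exact cg.
    + apply incr; assumption.
    + split; apply incr; assumption.
    + intros t ht; unfold comp, id.
      destruct (intermediate_value phi dphi s1 s2 t) as [z [hz <-]]; [lra| |exact ht|].
      * intros z hz; apply dv, inside, hz.
      * rewrite inv; [reflexivity | apply inside, hz].
    + rewrite val; generalize (pos s hs); lra.
  - rewrite val; unfold Rdiv; apply Rmult_1_l.
Qed.

(** * Solutions of the soliton system *)

Definition excess (y theta : R -> R) (s : R) : R :=
  y s - sin (theta s) * cos (theta s).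

Lemma angular_speed_excess (y t : R) : 0 < y -> 0 < t < PI ->
  1 / sin t - cos t / y = (y - sin t * cos t) / (y * sin t).
Proof.
  intros y0 tr; assert (0 < sin t) by (apply sin_gt_0; lra).
  field; lra.
Qed.

Section Solution.

Context {y0 : R} {sm sM : Rbar} {x y theta : R -> R}.
Context (sol : solution y0 sm sM x y theta).

Let y_pos := sol_y_pos _ _ _ _ _ _ sol.
Let theta_range := sol_theta_range _ _ _ _ _ _ sol.
Let dy := sol_y _ _ _ _ _ _ sol.
Let dtheta := sol_theta _ _ _ _ _ _ sol.

Lemma in_itv_0 : in_itv sm sM 0.
Proof. split; [apply (sol_left _ _ _ _ _ _ sol) | apply (sol_right _ _ _ _ _ _ sol)]. Qed.

Lemma sin_theta_pos (s : R) : in_itv sm sM s -> 0 < sin (theta s).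
Proof. intros hs; apply sin_gt_0; apply theta_range, hs. Qed.

Lemma y_increasing (s t : R) :
  in_itv sm sM s -> in_itv sm sM t -> s < t -> y s < y t.
Proof.
  intros [hs _] [_ ht] lt.
  apply (incr_function y sm sM (fun s => sin (theta s))); auto; intros z h1 h2;
    [apply dy | apply sin_theta_pos]; split; assumption.
Qed.

Lemma theta_derive_excess (s : R) : in_itv sm sM s ->
  is_derive theta s (excess y theta s / (y s * sin (theta s))).
Proof.
  intros hs; unfold excess.
  rewrite <- angular_speed_excess; [apply dtheta | apply y_pos | apply theta_range];
    exact hs.
Qed.

(** The second term is [cos (2 theta) * theta'], written with [excess] as a factor: at a zero of
    [excess] only [sin theta > 0] remains, so zeros are crossed upwards. *)
Lemma excess_derive (s : R) : in_itv sm sM s ->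
  is_derive (excess y theta) s
    (sin (theta s) - (cos (theta s) * cos (theta s) - sin (theta s) * sin (theta s))
                     * (excess y theta s / (y s * sin (theta s)))).
Proof.
  intros hs; unfold excess at 1.
  assert (d1 := dy s hs); assert (d2 := theta_derive_excess s hs).
  set (w := excess y theta s / (y s * sin (theta s))) in *.
  auto_derive.
  - split; [eexists; exact d1|]; split; [eexists; exact d2|].
    split; [eexists; exact d2 | exact I].
  - assert (e1 := is_derive_unique y s _ d1 : Derive y s = sin (theta s)).
    assert (e2 := is_derive_unique theta s _ d2 : Derive theta s = w).
    change (Derive (fun x : R => y x) s) with (Derive y s).
    change (Derive (fun x : R => theta x) s) with (Derive theta s).
    rewrite e1, e2; unfold w; ring.
Qed.

(** At [theta = PI / 2] the angular speed is exactly 1, so that angle can be passed only upwards;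
    hence time 0 separates the angles below [PI / 2] from those above. *)
Lemma theta_crossing (s t : R) : in_itv sm sM s -> in_itv sm sM t -> s < t ->
  PI / 2 <= theta s -> PI / 2 < theta t.
Proof.
  intros hs ht lt ge.
  assert (0 < theta t - PI / 2); [|lra].
  apply (positive_after (fun z => theta z - PI / 2)
           (fun z => 1 / sin (theta z) - cos (theta z) / y z) s t lt).
  - intros z hz.
    replace (1 / sin (theta z) - cos (theta z) / y z)
      with (1 / sin (theta z) - cos (theta z) / y z - 0) by ring.
    apply (is_derive_minus theta (fun _ => PI / 2)).
    + apply dtheta, (in_itv_convex _ _ _ _ _ hs ht hz).
    + apply (@is_derive_const R_AbsRing R_NormedModule).
  - intros z _ e; replace (theta z) with (PI / 2) by lra.
    rewrite sin_PI2, cos_PI2; lra.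
  - lra.
Qed.

Lemma theta_lt_of_neg (s : R) : in_itv sm sM s -> s < 0 -> theta s < PI / 2.
Proof.
  intros hs lt; apply Rnot_le_lt; intros ge.
  generalize (theta_crossing s 0 hs in_itv_0 lt ge).
  rewrite (sol_theta0 _ _ _ _ _ _ sol); lra.
Qed.

Lemma theta_ge_of_nonneg (s : R) : in_itv sm sM s -> 0 <= s -> PI / 2 <= theta s.
Proof.
  intros hs [lt| <-]; [|rewrite (sol_theta0 _ _ _ _ _ _ sol); lra].
  left; apply (theta_crossing 0 s in_itv_0 hs lt).
  rewrite (sol_theta0 _ _ _ _ _ _ sol); lra.
Qed.

Lemma theta_le_of_nonpos (s : R) : in_itv sm sM s -> s <= 0 -> theta s <= PI / 2.
Proof.
  intros hs [lt| ->]; [|rewrite (sol_theta0 _ _ _ _ _ _ sol); lra].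
  left; apply theta_lt_of_neg; assumption.
Qed.

Lemma cos_theta_nonpos (s : R) : in_itv sm sM s -> 0 <= s -> cos (theta s) <= 0.
Proof.
  intros hs ge; apply cos_le_0; [apply theta_ge_of_nonneg; assumption|].
  generalize (theta_range s hs); lra.
Qed.

Lemma excess_pos_of_nonneg (s : R) :
  in_itv sm sM s -> 0 <= s -> 0 < excess y theta s.
Proof.
  intros hs ge; unfold excess.
  generalize (y_pos s hs) (sin_theta_pos s hs) (cos_theta_nonpos s hs ge); nra.
Qed.

Lemma excess_crossing (s t : R) : in_itv sm sM s -> in_itv sm sM t -> s < t ->
  0 <= excess y theta s -> 0 < excess y theta t.
Proof.
  intros hs ht lt ge.
  assert (inside : forall z, s <= z <= t -> in_itv sm sM z).
  { intros z; apply in_itv_convex; assumption. }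
  eapply positive_after; [exact lt| | |exact ge].
  - intros z hz; apply excess_derive, inside, hz.
  - intros z hz e; simpl; rewrite e; unfold Rdiv.
    generalize (sin_theta_pos z (inside z hz)); lra.
Qed.

Lemma angular_speed_ge_1 (s : R) : in_itv sm sM s -> 0 <= s ->
  1 <= 1 / sin (theta s) - cos (theta s) / y s.
Proof.
  intros hs ge.
  assert (h1 := sin_theta_pos s hs); assert (h2 := cos_theta_nonpos s hs ge).
  assert (h3 : 1 <= / sin (theta s)).
  { rewrite <- Rinv_1; apply Rinv_le_contravar; [exact h1 | apply SIN_bound]. }
  assert (h4 : 0 < / y s) by (apply Rinv_0_lt_compat, y_pos, hs).
  unfold Rdiv; nra.
Qed.

Lemma theta_growth (s : R) : in_itv sm sM s -> 0 <= s -> PI / 2 + s <= theta s.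
Proof.
  intros hs ge.
  rewrite <- (sol_theta0 _ _ _ _ _ _ sol).
  assert (theta 0 - 0 <= theta s - s); [|lra].
  apply (nondecreasing_of_derive (fun z => theta z - z)
           (fun z => 1 / sin (theta z) - cos (theta z) / y z - 1) 0 s ge).
  - intros z hz; apply (is_derive_minus theta (fun z => z)).
    + apply dtheta, (in_itv_convex _ _ _ _ _ in_itv_0 hs hz).
    + apply (@is_derive_id R_AbsRing).
  - intros z hz.
    generalize (angular_speed_ge_1 z (in_itv_convex _ _ _ _ _ in_itv_0 hs hz)); lra.
Qed.

Lemma right_end_finite : exists c : R, sM = Finite c /\ 0 < c <= PI / 2.
Proof.
  assert (bd : forall s, in_itv sm sM s -> 0 <= s -> s <= PI / 2).
  { intros s hs ge; generalize (theta_growth s hs ge) (theta_range s hs); lra. }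
  destruct in_itv_0 as [h1 h2].
  assert (inside : forall s : R, 0 <= s -> Rbar_lt s sM -> in_itv sm sM s).
  { intros s ge lt; split; [|exact lt].
    eapply Rbar_lt_le_trans; [exact h1 | exact ge]. }
  generalize PI_RGT_0; intros pi0.
  destruct sM as [c| |]; simpl in h2.
  - exists c; split; [reflexivity|]; split; [exact h2|].
    apply Rnot_lt_le; intros lt.
    assert ((PI / 2 + c) / 2 <= PI / 2); [|lra].
    apply bd; [apply inside; simpl|]; lra.
  - assert (PI <= PI / 2); [|lra].
    apply bd; [apply inside; simpl; auto|]; lra.
  - contradiction.
Qed.

Lemma speed_bound_integrated (s0 k : R) : in_itv sm sM s0 ->
  (forall s, in_itv sm sM s -> s <= s0 -> k <= sin (theta s)) ->
  forall s, in_itv sm sM s -> s <= s0 -> k * (s0 - s) <= y s0 - y s.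
Proof.
  intros h0 low s hs le.
  assert (y s - k * s <= y s0 - k * s0); [|lra].
  apply (nondecreasing_of_derive (fun z => y z - k * z)
           (fun z => sin (theta z) - k) s s0 le).
  - intros z hz.
    apply (is_derive_minus y (fun z => k * z)).
    + apply dy, (in_itv_convex _ _ _ _ _ hs h0 hz).
    + auto_derive; [exact I | ring].
  - intros z hz; generalize (low z (in_itv_convex _ _ _ _ _ hs h0 hz)); lra.
Qed.

(** Backwards in time [y] falls at rate at least [k] and stays positive, so the domain cannot reach
    back to [s0 - y s0 / k]. *)
Lemma left_end_finite (s0 k : R) : in_itv sm sM s0 -> 0 < k ->
  (forall s, in_itv sm sM s -> s <= s0 -> k <= sin (theta s)) ->
  exists c : R, sm = Finite c.
Proof.
  intros h0 k0 low.
  assert (bd := speed_bound_integrated s0 k h0 low).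
  destruct sm as [c| |] eqn:e.
  - exists c; reflexivity.
  - destruct h0 as [[] _].
  - exfalso.
    assert (y00 := y_pos s0 h0).
    assert (q0 : 0 < y s0 / k) by (apply Rdiv_lt_0_compat; assumption).
    assert (hs : in_itv m_infty sM (s0 - y s0 / k)).
    { split; [exact I|]; eapply Rbar_le_lt_trans; [|apply h0]; simpl; lra. }
    specialize (bd _ hs ltac:(lra)).
    replace (k * (s0 - (s0 - y s0 / k))) with (y s0) in bd by (field; lra).
    generalize (y_pos _ hs); lra.
Qed.

Lemma y_limit_left (s0 : R) : in_itv sm sM s0 ->
  exists l, filterlim y (left_end sm) (locally l) /\ 0 <= l /\
    (forall s, in_itv sm sM s -> l < y s) /\
    forall z, l < z -> exists s, in_itv sm sM s /\ s < s0 /\ y s < z.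
Proof.
  intros h0.
  assert (mono : forall s t, in_itv sm sM s -> s < t -> t <= s0 -> y s <= y t).
  { intros s t hs lt le; left; apply y_increasing; [exact hs| |exact lt].
    apply (in_itv_convex _ _ s s0); [exact hs | exact h0 | lra]. }
  destruct (increasing_limit_left sm sM y 0 s0 h0 mono) as [l [h1 [h2 [h3 h4]]]].
  { intros s hs; left; apply y_pos, hs. }
  exists l; split; [exact h1|]; split; [exact h2|]; split; [|exact h4].
  (* A slightly earlier time makes the bound strict; the two cases extend it to times after [s0]. *)
  intros s hs; destruct (in_itv_between _ _ _ hs) as [s1 [_ [[lt _] [hs1 _]]]].
  destruct (Rle_dec s1 s0) as [le|nle].
  - generalize (h3 s1 hs1 le) (y_increasing s1 s hs1 hs lt); lra.
  - generalize (h3 s0 h0 (Rle_refl _)) (y_increasing s0 s h0 hs ltac:(lra)); lra.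
Qed.

Lemma trace_graph (J : R -> Prop) :
  (forall t, J t <-> exists s, in_itv sm sM s /\ y s = t) ->
  exists g : R -> R,
    graph_over J (fun t => x (g t)) sm sM x y /\
    forall s, in_itv sm sM s -> g (y s) = s /\ is_derive g (y s) (/ sin (theta s)).
Proof.
  intros hJ.
  destruct (inverse_derivable sm sM y (fun s => sin (theta s)) dy sin_theta_pos) as [g hg].
  exists g; split; [|exact hg].
  intros a t; split.
  - intros [s [hs [<- <-]]]; split; [apply hJ; exists s; auto|].
    rewrite (proj1 (hg s hs)); reflexivity.
  - intros [ht ->]; apply hJ in ht; destruct ht as [s [hs <-]].
    exists s; rewrite (proj1 (hg s hs)); auto.
Qed.

(** While [y >= 1], the quantity [2 theta - y] is nondecreasing in time. Falling backwards from [y0]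
    to height 1 would use up an angle of at least [(y0 - 1) / 2], whereas less than [PI / 2 <= 2] is
    available; this is the origin of 5. *)
Lemma height_ge_1 : 5 <= y0 -> forall s, in_itv sm sM s -> 1 <= y s.
Proof.
  intros y05.
  assert (nonpos : forall s, in_itv sm sM s -> s <= 0 -> 1 <= y s).
  { intros s hs le; apply Rnot_lt_le; intros lt.
    assert (inside : forall z, s <= z <= 0 -> in_itv sm sM z).
    { intros z; apply in_itv_convex; [exact hs | apply in_itv_0]. }
    destruct (intermediate_value y (fun z => sin (theta z)) s 0 1 le) as [z [hz e]].
    - intros z hz; apply dy, inside, hz.
    - rewrite (sol_y0 _ _ _ _ _ _ sol); lra.
    - assert (ge1 : forall t, z <= t <= 0 -> 1 <= y t).
      { intros t [[lt'| <-] ht]; [|lra].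
        generalize (y_increasing z t (inside z hz) (inside t ltac:(lra)) lt'); lra. }
      assert (decay : 2 * theta z - y z <= 2 * theta 0 - y 0).
      { apply (nondecreasing_of_derive (fun t => 2 * theta t - y t)
          (fun t => 2 * (1 / sin (theta t) - cos (theta t) / y t) - sin (theta t)));
          [apply hz| |].
        - intros t ht; assert (hti := inside t ltac:(lra)).
          apply (is_derive_minus (fun t => 2 * theta t) y); [|apply dy, hti].
          apply (is_derive_scal theta), dtheta, hti.
        - intros t ht; assert (hti := inside t ltac:(lra)).
          assert (s0 := sin_theta_pos t hti); assert (g1 := ge1 t ht).
          replace (2 * (1 / sin (theta t) - cos (theta t) / y t) - sin (theta t))
            with ((2 * y t - 2 * (sin (theta t) * cos (theta t))
                   - sin (theta t) * sin (theta t) * y t) * / (sin (theta t) * y t))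
            by (field; lra).
          apply Rmult_le_pos; [|left; apply Rinv_0_lt_compat; nra].
          assert (p := sin2_cos2 (theta t)); unfold Rsqr in p.
          (* The numerator equals [(2 - sin^2) (y - 1) + (sin - cos)^2 + cos^2]. *)
          assert (0 <= (2 - sin (theta t) * sin (theta t)) * (y t - 1)).
          { apply Rmult_le_pos; [|lra].
            generalize (pow2_ge_0 (cos (theta t))); simpl; nra. }
          generalize (pow2_ge_0 (sin (theta t) - cos (theta t)))
                     (pow2_ge_0 (cos (theta t))); simpl; nra. }
      rewrite (sol_y0 _ _ _ _ _ _ sol), (sol_theta0 _ _ _ _ _ _ sol) in decay.
      generalize (theta_range z (inside z hz)) PI_4; lra. }
  intros s hs; destruct (Rle_dec s 0) as [le|nle]; [apply nonpos; assumption|].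
  generalize (y_increasing 0 s in_itv_0 hs ltac:(lra)).
  rewrite (sol_y0 _ _ _ _ _ _ sol); lra.
Qed.

Section PositiveExcess.

Context (excess_pos : forall s, in_itv sm sM s -> 0 < excess y theta s).

Lemma angular_speed_pos (s : R) : in_itv sm sM s ->
  0 < excess y theta s / (y s * sin (theta s)).
Proof.
  intros hs; apply Rdiv_lt_0_compat; [apply excess_pos, hs|].
  apply Rmult_lt_0_compat; [apply y_pos | apply sin_theta_pos]; exact hs.
Qed.

Lemma theta_increasing (s t : R) :
  in_itv sm sM s -> in_itv sm sM t -> s < t -> theta s < theta t.
Proof.
  intros [hs _] [_ ht] lt.
  apply (incr_function theta sm sM (fun s => excess y theta s / (y s * sin (theta s))));
    auto; intros z h1 h2;
    [apply theta_derive_excess | apply angular_speed_pos]; split; assumption.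
Qed.

End PositiveExcess.

End Solution.

(** * Behaviour of maximal solutions at the two ends *)

Section MaximalSolution.

Context {y0 : R} {sm sM : Rbar} {x y theta : R -> R}.
Context (mx : maximal_solution y0 sm sM x y theta).

Let sol : solution y0 sm sM x y theta := proj1 mx.

(** For [s >= 0] both [y] and [theta] increase, and [y] is bounded because [y' <= 1] over a finite
    time. A limiting angle below [PI] would be a regular limit point, against maximality. The last
    two clauses serve to identify [l] as the upper end of the range of [y]. *)
Lemma right_end_limits : exists l, 0 < l /\
  filterlim y (right_end sM) (locally l) /\
  filterlim theta (right_end sM) (locally PI) /\
  (forall s, in_itv sm sM s -> y s < l) /\
  forall z, z < l -> exists s, in_itv sm sM s /\ z < y s.
Proof.
  assert (i0 := in_itv_0 sol).
  assert (inside : forall s t, in_itv sm sM t -> 0 <= s -> s <= t -> in_itv sm sM s).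
  { intros s t ht h1 h2; apply (in_itv_convex _ _ 0 t); try assumption; lra. }
  destruct (right_end_finite sol) as [c [e c0]].
  assert (ub : forall s, in_itv sm sM s -> y s <= y0 + c).
  { intros s hs; destruct (Rle_dec 0 s) as [ge|nge].
    - assert (0 - y 0 <= s - y s).
      { apply (nondecreasing_of_derive (fun z => z - y z)
                 (fun z => 1 - sin (theta z)) 0 s ge).
        - intros z hz; apply (is_derive_minus (fun z => z) y).
          + apply (@is_derive_id R_AbsRing).
          + apply (sol_y _ _ _ _ _ _ sol), (inside z s hs); lra.
        - intros z _; generalize (SIN_bound (theta z)); lra. }
      rewrite (sol_y0 _ _ _ _ _ _ sol) in *.
      destruct hs as [_ hs]; rewrite e in hs; simpl in hs; lra.
    - generalize (y_increasing sol s 0 hs i0 ltac:(lra)).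
      rewrite (sol_y0 _ _ _ _ _ _ sol); lra. }
  destruct (increasing_limit_right sm sM y (y0 + c) 0 i0) as [l [ly [_ [above reach]]]].
  { intros s t ht lt ge; left; apply (y_increasing sol); try assumption.
    apply (inside s t); [exact ht | lra | lra]. }
  { exact ub. }
  destruct (increasing_limit_right sm sM theta PI 0 i0) as [m [lt [mle [tabove _]]]].
  { intros s t ht lt ge.
    apply (nondecreasing_of_derive theta
      (fun z => 1 / sin (theta z) - cos (theta z) / y z)); [lra| |].
    - intros z hz; apply (sol_theta _ _ _ _ _ _ sol), (inside z t ht); lra.
    - intros z hz.
      generalize (angular_speed_ge_1 sol z (inside z t ht ltac:(lra) ltac:(lra))
                    ltac:(lra)); lra. }
  { intros s hs; left; apply (sol_theta_range _ _ _ _ _ _ sol), hs. }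
  assert (l0 : 0 < l).
  { generalize (above 0 i0 (Rle_refl 0)) (sol_y_pos _ _ _ _ _ _ sol 0 i0); lra. }
  assert (m0 : 0 < m).
  { generalize (tabove 0 i0 (Rle_refl 0)) (sol_theta_range _ _ _ _ _ _ sol 0 i0); lra. }
  assert (mpi : m = PI).
  { destruct mle as [ltpi|eq]; [exfalso|exact eq].
    assert (mx' := mx); rewrite e in mx', ly, lt.
    apply (no_regular_limit_right y0 c l m sm x y theta mx'); try assumption; lra. }
  exists l; split; [exact l0|]; split; [exact ly|].
  split; [rewrite <- mpi; exact lt|]; split.
  - intros s hs; destruct (in_itv_between _ _ _ hs) as [_ [s2 [[_ lt2] [_ h2]]]].
    destruct (Rle_dec 0 s2) as [ge|nge].
    + generalize (above s2 h2 ge) (y_increasing sol s s2 hs h2 lt2); lra.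
    + generalize (above 0 i0 (Rle_refl 0)) (y_increasing sol s 0 hs i0 ltac:(lra)); lra.
  - intros z hz; destruct (reach z hz) as [s [hs [_ lts]]]; exists s; auto.
Qed.

(* Once the excess is nonpositive, theta decreases; if its limit at the left
   end were m < PI / 2, then theta + cos m * ln y would have a bounded
   derivative although ln y tends to -oo. *)
Lemma orthogonal_left_end (s0 : R) :
  in_itv sm sM s0 -> excess y theta s0 <= 0 ->
  filterlim y (left_end sm) (locally 0) /\
  filterlim theta (left_end sm) (locally (PI / 2)).
Proof.
  intros h0 neg.
  assert (i0 := in_itv_0 sol).
  assert (s0neg : s0 < 0).
  { apply Rnot_le_lt; intros ge; generalize (excess_pos_of_nonneg sol s0 h0 ge); lra. }
  assert (inside : forall s t, in_itv sm sM s -> s <= t -> t <= s0 -> in_itv sm sM t).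
  { intros s t hs h1 h2; apply (in_itv_convex _ _ s s0); try assumption; lra. }
  assert (negs : forall s, in_itv sm sM s -> s <= s0 -> excess y theta s <= 0).
  { intros s hs [lt| ->]; [|exact neg].
    apply Rnot_lt_le; intros pos.
    generalize (excess_crossing sol s s0 hs h0 lt ltac:(lra)); lra. }
  assert (decr : forall s t, in_itv sm sM s -> s < t -> t <= s0 -> - theta s <= - theta t).
  { intros s t hs lt le.
    apply (nondecreasing_of_derive (fun z => - theta z)
             (fun z => - (excess y theta z / (y z * sin (theta z))))); [lra| |].
    - intros z hz; apply (is_derive_opp theta), (theta_derive_excess sol).
      apply (inside s); [exact hs | lra | lra].
    - intros z hz; assert (hzi := inside s z hs ltac:(lra) ltac:(lra)).
      assert (d0 : 0 < / (y z * sin (theta z))).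
      { apply Rinv_0_lt_compat, Rmult_lt_0_compat;
          [apply (sol_y_pos _ _ _ _ _ _ sol) | apply (sin_theta_pos sol)]; exact hzi. }
      generalize (negs z hzi ltac:(lra)); unfold Rdiv; nra. }
  set (k := sin (theta s0)).
  assert (k0 : 0 < k) by (apply (sin_theta_pos sol), h0).
  assert (t0 := sol_theta_range _ _ _ _ _ _ sol s0 h0).
  (* Up to [s0] the angle stays in [[theta s0, PI / 2]], where the sine is at least [k]; this forces
     a finite left end. *)
  assert (low : forall s, in_itv sm sM s -> s <= s0 -> k <= sin (theta s)).
  { intros s hs [lt| ->]; [|apply Rle_refl].
    generalize (theta_le_of_nonpos sol s hs ltac:(lra)) (decr s s0 hs lt (Rle_refl _)).
    intros; apply sin_incr_1; lra. }
  destruct (left_end_finite sol s0 k h0 k0 low) as [c e].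
  destruct (y_limit_left sol s0 h0) as [l [ly [l0 [above reach]]]].
  destruct (increasing_limit_left sm sM (fun s => - theta s) (- PI) s0 h0 decr)
    as [m' [lt' [_ [tbelow _]]]].
  { intros s hs; generalize (sol_theta_range _ _ _ _ _ _ sol s hs); lra. }
  assert (lt : filterlim theta (left_end sm) (locally (- m'))).
  { apply (filterlim_ext (fun s => - - theta s)); [intros; ring|].
    apply (filterlim_comp _ _ _ (fun s => - theta s) Ropp _ (locally m')); [exact lt'|].
    apply (filterlim_opp m'). }
  set (m := - m') in *.
  assert (tle : forall s, in_itv sm sM s -> s <= s0 -> theta s <= m).
  { intros s hs le; generalize (tbelow s hs le); unfold m; lra. }
  assert (m0 : theta s0 <= m) by (apply tle; [exact h0 | lra]).
  assert (mle : m <= PI / 2).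
  { apply Rnot_lt_le; intros gt.
    assert (e0 : 0 < m - PI / 2) by lra.
    assert (ev := proj1 (filterlim_locally theta m) lt (mkposreal _ e0)).
    assert (ev' : left_end sm (fun s => theta s <= PI / 2)).
    { apply (left_end_intro sm sM 0); [exact i0|].
      intros s hs hs0; apply (theta_le_of_nonpos sol); [exact hs | lra]. }
    assert (pf : ProperFilter (left_end sm)).
    { rewrite e; apply at_right_proper_filter. }
    destruct (filter_ex _ (filter_and _ _ ev ev')) as [s [h1 h2]].
    change (Rabs (theta s - m) < m - PI / 2) in h1; apply Rabs_def2 in h1; lra. }
  assert (mx' := mx); rewrite e in mx'.
  assert (lz : l = 0).
  { destruct l0 as [lpos|eq]; [exfalso|symmetry; exact eq].
    rewrite e in ly, lt.
    apply (no_regular_limit_left y0 c l m sM x y theta mx'); try assumption.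
    generalize PI_RGT_0; lra. }
  rewrite lz in ly, reach; split; [exact ly|].
  destruct mle as [mlt|meq]; [exfalso|rewrite <- meq; exact lt].
  set (q := cos m).
  assert (q0 : 0 < q) by (apply cos_gt_0; lra).
  assert (q1 : q <= 1) by apply COS_bound.
  (* With [theta s < PI], [0 < theta s0] and [c < s], the inequality [bound] below yields
     [q * ln (y s) > - B]; the time [s] is picked to violate this. *)
  set (B := PI + / k * (s0 - c) - q * ln (y s0)).
  destruct (reach (exp (- B / q)) (exp_pos _)) as [s [hs [lts small]]].
  assert (ys := sol_y_pos _ _ _ _ _ _ sol s hs).
  assert (ys0 := sol_y_pos _ _ _ _ _ _ sol s0 h0).
  assert (lns : q * ln (y s) < - B).
  { assert (ln (y s) < - B / q).
    { rewrite <- (ln_exp (- B / q)); apply ln_increasing; assumption. }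
    replace (- B) with (q * (- B / q)) by (field; lra).
    apply Rmult_lt_compat_l; assumption. }
  (* The derivative of [theta + q ln y] is at most [/ k]: since [q sin theta <= q <= cos theta], the
     terms in [/ y] add up to something nonpositive. *)
  assert (bound : / k * s - (theta s + q * ln (y s))
                  <= / k * s0 - (theta s0 + q * ln (y s0))).
  { apply (nondecreasing_of_derive (fun z => / k * z - (theta z + q * ln (y z)))
      (fun z => / k - ((1 / sin (theta z) - cos (theta z) / y z)
                       + q * (sin (theta z) * / y z)))); [lra| |].
    - intros z hz; assert (hzi := inside s z hs ltac:(lra) ltac:(lra)).
      apply (is_derive_minus (fun z => / k * z) (fun z => theta z + q * ln (y z))).
      + auto_derive; [exact I | ring].
      + apply (is_derive_plus theta (fun z => q * ln (y z))).
        * apply (sol_theta _ _ _ _ _ _ sol), hzi.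
        * apply (is_derive_scal (fun z => ln (y z))).
          apply (is_derive_comp ln y); [|apply (sol_y _ _ _ _ _ _ sol), hzi].
          apply is_derive_Reals, derivable_pt_lim_ln, (sol_y_pos _ _ _ _ _ _ sol), hzi.
    - intros z hz; assert (hzi := inside s z hs ltac:(lra) ltac:(lra)).
      assert (p1 := sin_theta_pos sol z hzi).
      assert (p2 : 0 < / y z) by (apply Rinv_0_lt_compat, (sol_y_pos _ _ _ _ _ _ sol), hzi).
      assert (p3 : / sin (theta z) <= / k).
      { apply Rinv_le_contravar; [exact k0 | apply low; [exact hzi | lra]]. }
      assert (p4 : q <= cos (theta z)).
      { assert (r := sol_theta_range _ _ _ _ _ _ sol z hzi).
        assert (r2 := tle z hzi ltac:(lra)).
        unfold q; apply cos_decr_1; generalize PI_RGT_0; lra. }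
      assert (p5 := proj2 (SIN_bound (theta z))).
      assert (q * sin (theta z) <= cos (theta z)) by nra.
      unfold Rdiv; nra. }
  assert (cs : c < s) by (destruct hs as [hs _]; rewrite e in hs; exact hs).
  assert (ik : 0 < / k) by (apply Rinv_0_lt_compat, k0).
  assert (/ k * c <= / k * s) by (apply Rmult_le_compat_l; lra).
  assert (r := sol_theta_range _ _ _ _ _ _ sol s hs).
  unfold B in lns; rewrite Rmult_minus_distr_l in lns; lra.
Qed.

Section PositiveExcess.

Context (excess_pos : forall s, in_itv sm sM s -> 0 < excess y theta s).

(** If [theta] stayed at least [e], the sine would be bounded below and the left end finite;
    positive excess would keep [y] above [sin theta cos theta], also bounded below. The limit would
    be a regular point, against maximality. *)
Lemma theta_small (e : R) : 0 < e -> exists s, in_itv sm sM s /\ s < 0 /\ theta s < e.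
Proof.
  intros e0; apply NNPP; intros no.
  assert (i0 := in_itv_0 sol).
  assert (mono : forall s t, in_itv sm sM s -> s < t -> t <= 0 -> theta s <= theta t).
  { intros s t hs lt le; left; apply (theta_increasing sol excess_pos); try assumption.
    apply (in_itv_convex _ _ s 0); try assumption; lra. }
  destruct (increasing_limit_left sm sM theta 0 0 i0 mono) as [m [lt [_ [above reach]]]].
  { intros s hs; left; apply (sol_theta_range _ _ _ _ _ _ sol), hs. }
  assert (m0 : e <= m).
  { apply Rnot_lt_le; intros me; destruct (reach e me) as [s hs].
    apply no; exists s; exact hs. }
  (* A time strictly before 0 has an angle below [PI / 2], which gives a positive lower bound for
     the cosine. *)
  destruct (in_itv_between _ _ _ i0) as [s1 [_ [[s1neg _] [h1 _]]]].
  assert (m1 := above s1 h1 ltac:(lra)).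
  assert (t1 := theta_lt_of_neg sol s1 h1 s1neg).
  assert (k0 : 0 < sin m) by (apply sin_gt_0; lra).
  assert (q0 : 0 < cos (theta s1)) by (apply cos_gt_0; lra).
  assert (trange : forall s, in_itv sm sM s -> s <= s1 -> m <= theta s <= theta s1).
  { intros s hs [lts| ->]; split; try lra; [apply above; [exact hs | lra]|].
    apply mono; [exact hs | exact lts | lra]. }
  assert (low : forall s, in_itv sm sM s -> s <= s1 -> sin m <= sin (theta s)).
  { intros s hs le; generalize (trange s hs le); intros; apply sin_incr_1; lra. }
  destruct (left_end_finite sol s1 (sin m) h1 k0 low) as [c ec].
  destruct (y_limit_left sol s1 h1) as [l [ly [_ [_ yreach]]]].
  assert (l0 : 0 < l).
  { apply Rnot_le_lt; intros le.
    destruct (yreach (sin m * cos (theta s1))) as [s [hs [lts small]]]; [nra|].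
    generalize (excess_pos s hs); unfold excess.
    assert (sl := low s hs ltac:(lra)).
    assert (cos (theta s1) <= cos (theta s)).
    { generalize (trange s hs ltac:(lra)); intros; apply cos_decr_1; lra. }
    assert (sin m * cos (theta s1) <= sin (theta s) * cos (theta s)).
    { apply Rmult_le_compat; lra. }
    lra. }
  assert (mx' := mx); rewrite ec in mx', ly, lt.
  apply (no_regular_limit_left y0 c l m sM x y theta mx'); try assumption; lra.
Qed.

Lemma theta_attains (t : R) : 0 < t <= PI / 2 ->
  exists s, in_itv sm sM s /\ s <= 0 /\ theta s = t.
Proof.
  intros ht; destruct (theta_small t (proj1 ht)) as [s [hs [neg lt]]].
  assert (i0 := in_itv_0 sol).
  destruct (intermediate_value theta (fun z => 1 / sin (theta z) - cos (theta z) / y z)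
              s 0 t) as [z [hz ez]]; [lra| | |].
  - intros z hz; apply (sol_theta _ _ _ _ _ _ sol), (in_itv_convex _ _ s 0); assumption.
  - rewrite (sol_theta0 _ _ _ _ _ _ sol); lra.
  - exists z; split; [apply (in_itv_convex _ _ s 0); assumption|]; split; [lra | exact ez].
Qed.

(** The angle [PI / 4] maximizes [sin cos], so positive excess there gives the largest bound. It is
    what makes the critical height positive. *)
Lemma half_lt_initial_height : 1 / 2 < y0.
Proof.
  assert (p := PI_RGT_0).
  destruct (theta_attains (PI / 4)) as [s [hs [le e]]]; [lra|].
  assert (h := excess_pos s hs); unfold excess in h.
  rewrite e, sin_PI4, cos_PI4 in h.
  assert (r : sqrt 2 * sqrt 2 = 2) by (apply sqrt_sqrt; lra).
  assert (r0 : 0 < sqrt 2) by (apply sqrt_lt_R0; lra).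
  replace (1 / sqrt 2 * (1 / sqrt 2)) with (/ (sqrt 2 * sqrt 2)) in h by (field; lra).
  rewrite r in h; rewrite <- (sol_y0 _ _ _ _ _ _ sol).
  destruct le as [lt| ->]; [|lra].
  generalize (y_increasing sol s 0 hs (in_itv_0 sol) lt); lra.
Qed.

End PositiveExcess.

End MaximalSolution.

(** * Comparison of solitons and the critical height *)

(* Over theta in (0, PI / 2] the first curve is a graph y = Y1 theta, and
   D = y2 - Y1 theta2 satisfies D' = - a D with a >= 0, so D only grows
   towards the left end. *)
Lemma height_comparison (a1 a2 : R) (sm1 sM1 sm2 sM2 : Rbar)
    (x1 y1 t1 x2 y2 t2 : R -> R) :
  maximal_solution a1 sm1 sM1 x1 y1 t1 ->
  (forall s, in_itv sm1 sM1 s -> 0 < excess y1 t1 s) ->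
  solution a2 sm2 sM2 x2 y2 t2 -> a1 < a2 ->
  forall s, in_itv sm2 sM2 s -> s <= 0 ->
    a2 - a1 <= y2 s /\ 0 < excess y2 t2 s.
Proof.
  intros mx1 pos1 sol2 lt12 s hs s0.
  assert (sol1 := proj1 mx1).
  assert (inside : forall z, s <= z <= 0 -> in_itv sm2 sM2 z).
  { intros z; apply in_itv_convex; [exact hs | apply (in_itv_0 sol2)]. }
  set (W1 := fun z => excess y1 t1 z / (y1 z * sin (t1 z))).
  set (W2 := fun z => excess y2 t2 z / (y2 z * sin (t2 z))).
  destruct (inverse_derivable sm1 sM1 t1 W1) as [g hg].
  { intros; apply (theta_derive_excess sol1); assumption. }
  { intros; apply (angular_speed_pos sol1); assumption. }
  assert (match_angle : forall z, s <= z <= 0 ->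
    in_itv sm1 sM1 (g (t2 z)) /\ t1 (g (t2 z)) = t2 z /\
    is_derive g (t2 z) (/ W1 (g (t2 z)))).
  { intros z hz.
    destruct (theta_attains mx1 pos1 (t2 z)) as [u [hu [_ <-]]].
    - split; [apply (sol_theta_range _ _ _ _ _ _ sol2), inside, hz|].
      apply (theta_le_of_nonpos sol2); [apply inside, hz | apply hz].
    - destruct (hg u hu) as [e d]; rewrite e; auto. }
  set (D := fun z => y2 z - y1 (g (t2 z))).
  set (dD := fun z => sin (t2 z) - W2 z * / W1 (g (t2 z)) * sin (t1 (g (t2 z)))).
  assert (derD : forall z, s <= z <= 0 -> is_derive D z (dD z)).
  { intros z hz; destruct (match_angle z hz) as [h1 [h2 h3]].
    apply (is_derive_minus y2 (fun z => y1 (g (t2 z)))).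
    - apply (sol_y _ _ _ _ _ _ sol2), inside, hz.
    - apply (is_derive_comp y1 (fun z => g (t2 z))).
      + apply (sol_y _ _ _ _ _ _ sol1), h1.
      + apply (is_derive_comp g t2); [exact h3|].
        apply (theta_derive_excess sol2), inside, hz. }
  assert (sgn : forall z, s <= z <= 0 -> dD z * D z <= 0).
  { intros z hz; assert (hzi := inside z hz).
    destruct (match_angle z hz) as [h1 [h2 h3]].
    assert (p1 := sol_y_pos _ _ _ _ _ _ sol1 _ h1).
    assert (p2 := sol_y_pos _ _ _ _ _ _ sol2 _ hzi).
    assert (p3 := sin_theta_pos sol2 z hzi).
    assert (p4 : 0 <= cos (t2 z)).
    { apply cos_ge_0; [|apply (theta_le_of_nonpos sol2); [exact hzi | apply hz]].
      generalize (sol_theta_range _ _ _ _ _ _ sol2 z hzi) PI_RGT_0; lra. }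
    assert (p5 := pos1 _ h1).
    unfold dD, W2, W1, D, excess in *; rewrite h2 in *.
    set (S := sin (t2 z)) in *; set (C := cos (t2 z)) in *.
    set (v1 := y1 (g (t2 z))) in *; set (v2 := y2 z) in *.
    (* Here [a = S ^ 2 * C / (v2 * (v1 - S * C))], nonnegative because the angle is at most
       [PI / 2]; of the two excesses only that of the first curve enters. *)
    replace ((S - (v2 - S * C) / (v2 * S) * / ((v1 - S * C) / (v1 * S)) * S)
             * (v2 - v1))
      with (- (S * S * C * (v2 - v1) ^ 2 * / (v2 * (v1 - S * C))))
      by (field; repeat split; lra).
    assert (0 <= S * S * C * (v2 - v1) ^ 2 * / (v2 * (v1 - S * C))); [|lra].
    apply Rmult_le_pos.
    - apply Rmult_le_pos; [|apply pow2_ge_0].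
      apply Rmult_le_pos; [nra | exact p4].
    - left; apply Rinv_0_lt_compat, Rmult_lt_0_compat; assumption. }
  assert (g0 : g (PI / 2) = 0).
  { rewrite <- (sol_theta0 _ _ _ _ _ _ sol1); apply hg, (in_itv_0 sol1). }
  assert (D0 : D 0 = a2 - a1).
  { unfold D; rewrite (sol_theta0 _ _ _ _ _ _ sol2), g0.
    rewrite (sol_y0 _ _ _ _ _ _ sol1), (sol_y0 _ _ _ _ _ _ sol2); reflexivity. }
  (* The square of [D] is nonincreasing in time whatever the sign of [D]. The sign is settled next:
     a zero of [D] would contradict this bound. *)
  assert (sq : forall z, s <= z <= 0 -> D 0 * D 0 <= D z * D z).
  { intros z hz; assert (- (D z * D z) <= - (D 0 * D 0)); [|lra].
    apply (nondecreasing_of_derive (fun u => - (D u * D u))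
             (fun u => - (dD u * D u + D u * dD u))); [apply hz| |].
    - intros u hu; apply (is_derive_opp (fun u => D u * D u)).
      apply (is_derive_mult D D); [apply derD; lra | apply derD; lra | apply Rmult_comm].
    - intros u hu; generalize (sgn u ltac:(lra)); lra. }
  assert (Dpos : 0 < D s).
  { apply Rnot_le_lt; intros le.
    destruct (intermediate_value D dD s 0 0 s0 derD) as [z [hz e]]; [lra|].
    generalize (sq z hz); rewrite e; nra. }
  assert (DD : a2 - a1 <= D s).
  { generalize (sq s ltac:(lra)); rewrite D0; nra. }
  (* At equal angle the second excess is the first plus [D s], and [y2 s] exceeds [D s] because [y1]
     is positive. *)
  destruct (match_angle s ltac:(lra)) as [h1 [h2 _]].
  assert (p1 := sol_y_pos _ _ _ _ _ _ sol1 _ h1).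
  assert (p5 := pos1 _ h1).
  unfold excess in *; rewrite h2 in p5; unfold D in *; lra.
Qed.

(** * Slopes and concavity of the graph *)

Lemma cot_decreasing (s t : R) : 0 < s -> s < t -> t < PI ->
  cos t / sin t < cos s / sin s.
Proof.
  intros s0 lt tp.
  assert (h1 : 0 < sin s) by (apply sin_gt_0; lra).
  assert (h2 : 0 < sin t) by (apply sin_gt_0; lra).
  assert (h3 : 0 < sin (t - s)) by (apply sin_gt_0; lra).
  rewrite sin_minus in h3.
  assert (0 < cos s / sin s - cos t / sin t); [|lra].
  replace (cos s / sin s - cos t / sin t)
    with ((sin t * cos s - cos t * sin s) * / (sin s * sin t)) by (field; lra).
  apply Rmult_lt_0_compat; [exact h3|].
  apply Rinv_0_lt_compat, Rmult_lt_0_compat; assumption.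
Qed.

(** Translates a threshold [K] for the slope of the graph into a threshold for the angle. *)
Lemma cot_surjective (K : R) : exists t, 0 < t < PI /\ cos t / sin t = K.
Proof.
  exists (PI / 2 - atan K).
  generalize (atan_bound K); intros b; split; [lra|].
  rewrite <- (tan_atan K) at 3; unfold tan.
  rewrite cos_shift, sin_shift; reflexivity.
Qed.

(** A nonincreasing derivative keeps the graph below each tangent; for the tangent at
    [t * a + (1 - t) * b] the weighted linear terms cancel. *)
Lemma concave_of_derive_decreasing (m M : R) (f df : R -> R) :
  (forall t, m < t < M -> is_derive f t (df t)) ->
  (forall s t, m < s -> s <= t -> t < M -> df t <= df s) ->
  concave_on m M f.
Proof.
  intros dv decr.
  assert (mvt : forall a b, m < a < M -> m < b < M -> exists c,
    Rmin a b <= c <= Rmax a b /\ m < c < M /\ f b - f a = df c * (b - a)).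
  { intros a b ha hb.
    assert (inside : forall c, Rmin a b <= c <= Rmax a b -> m < c < M).
    { intros c; unfold Rmin, Rmax; destruct Rle_dec; lra. }
    destruct (MVT_gen f a b df) as [c [hc e]].
    - intros c hc; apply dv, inside; lra.
    - intros c hc; apply continuity_pt_filterlim, is_derive_continuous with (df c).
      apply dv, inside, hc.
    - exists c; auto. }
  assert (tangent : forall p a, m < p < M -> m < a < M -> f a <= f p + df p * (a - p)).
  { intros p a hp ha; destruct (mvt p a hp ha) as [c [hc [hcm e]]].
    assert (df c * (a - p) <= df p * (a - p)); [|lra].
    unfold Rmin, Rmax in hc; destruct Rle_dec as [le|nle] in hc.
    - generalize (decr p c ltac:(lra) ltac:(lra) ltac:(lra)); nra.
    - generalize (decr c p ltac:(lra) ltac:(lra) ltac:(lra)); nra. }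
  intros a b t ha hb ht.
  set (p := t * a + (1 - t) * b).
  assert (hp : m < p < M).
  { unfold p; destruct (Rle_dec a b); split; nra. }
  assert (h1 := tangent p a hp ha); assert (h2 := tangent p b hp hb).
  assert (t * f a <= t * (f p + df p * (a - p))) by (apply Rmult_le_compat_l; lra).
  assert ((1 - t) * f b <= (1 - t) * (f p + df p * (b - p)))
    by (apply Rmult_le_compat_l; lra).
  assert (t * (df p * (a - p)) + (1 - t) * (df p * (b - p)) = 0)
    by (unfold p; ring).
  lra.
Qed.

(** The slope of the graph is [cot theta]. Under positive excess [theta] increases together with
    [y], so the slope decreases, and its end limits come from [theta] approaching [PI] and 0. The
    bound [d] makes [m] positive. *)
Lemma concave_graph (y0 d : R) (sm sM : Rbar) (x y theta : R -> R) :
  maximal_solution y0 sm sM x y theta ->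
  (forall s, in_itv sm sM s -> 0 < excess y theta s) ->
  0 < d -> (forall s, in_itv sm sM s -> d <= y s) ->
  exists (m M : R) (f : R -> R),
    0 < m < M /\
    graph_over (fun t => m < t < M) f sm sM x y /\
    (forall t, m < t < M -> ex_derive f t) /\
    concave_on m M f /\
    filterlim (Derive f) (at_left M) (Rbar_locally m_infty) /\
    filterlim (Derive f) (at_right m) (Rbar_locally p_infty).
Proof.
  intros mx pos d0 low.
  assert (sol := proj1 mx); assert (i0 := in_itv_0 sol).
  destruct (y_limit_left sol 0 i0) as [m [_ [_ [above reach]]]].
  destruct (right_end_limits mx) as [M [_ [_ [tlim [below reach']]]]].
  assert (dm : d <= m).
  { apply Rnot_lt_le; intros lt; destruct (reach d lt) as [s [hs [_ ys]]].
    generalize (low s hs); lra. }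
  assert (image : forall t, m < t < M <-> exists s, in_itv sm sM s /\ y s = t).
  { intros t; split.
    - intros [h1 h2].
      destruct (reach t h1) as [s [hs [_ ls]]].
      destruct (reach' t h2) as [u [hu lu]].
      assert (su : s <= u).
      { apply Rnot_lt_le; intros lt; generalize (y_increasing sol u s hu hs lt); lra. }
      destruct (intermediate_value y (fun z => sin (theta z)) s u t su) as [z [hz e]].
      + intros z hz; apply (sol_y _ _ _ _ _ _ sol), (in_itv_convex _ _ s u); assumption.
      + lra.
      + exists z; split; [apply (in_itv_convex _ _ s u); assumption | exact e].
    - intros [s [hs <-]]; split; [apply above | apply below]; exact hs. }
  destruct (trace_graph sol (fun t => m < t < M) image) as [g [graph hg]].
  set (cot := fun s => cos (theta s) / sin (theta s)).
  assert (df : forall s, in_itv sm sM s -> is_derive (fun t => x (g t)) (y s) (cot s)).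
  { intros s hs; destruct (hg s hs) as [e dg].
    unfold cot, Rdiv; rewrite (Rmult_comm (cos _)).
    apply (is_derive_comp x g); [|exact dg].
    rewrite e; apply (sol_x _ _ _ _ _ _ sol), hs. }
  assert (cot_lt : forall s t, in_itv sm sM s -> in_itv sm sM t -> s < t -> cot t < cot s).
  { intros s t hs ht lt; apply cot_decreasing.
    - apply (sol_theta_range _ _ _ _ _ _ sol), hs.
    - apply (theta_increasing sol pos); assumption.
    - apply (sol_theta_range _ _ _ _ _ _ sol), ht. }
  assert (df' : forall t, m < t < M ->
    in_itv sm sM (g t) /\ y (g t) = t /\ is_derive (fun t => x (g t)) t (cot (g t))).
  { intros t ht; apply image in ht; destruct ht as [s [hs <-]].
    rewrite (proj1 (hg s hs)); auto. }
  assert (order : forall s t, in_itv sm sM s -> m < t < M -> y s < t -> s < g t).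
  { intros s t hs ht lt; destruct (df' t ht) as [h1 [h2 _]].
    apply Rnot_le_lt; intros [l'|e]; [|rewrite <- e in lt; lra].
    generalize (y_increasing sol (g t) s h1 hs l'); lra. }
  assert (order' : forall s t, in_itv sm sM s -> m < t < M -> t < y s -> g t < s).
  { intros s t hs ht lt; destruct (df' t ht) as [h1 [h2 _]].
    apply Rnot_le_lt; intros [l'|e]; [|rewrite e in lt; lra].
    generalize (y_increasing sol s (g t) hs h1 l'); lra. }
  exists m, M, (fun t => x (g t)); split; [|split; [exact graph|]].
  { generalize (above 0 i0) (below 0 i0); lra. }
  split; [|split; [|split]].
  - intros t ht; eexists; apply df', ht.
  - apply concave_of_derive_decreasing with (fun t => cot (g t)).
    + intros t ht; apply df', ht.
    + intros s t h1 [lt| ->] h2; [|apply Rle_refl]; left.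
      assert (hs : m < s < M) by lra; assert (ht : m < t < M) by lra.
      destruct (df' s hs) as [i1 [e1 _]]; destruct (df' t ht) as [i2 _].
      apply cot_lt; try assumption; apply order; try assumption; lra.
  (* One time [s] with [cot s < K] suffices: by monotonicity every height above [y s] has a smaller
     slope. *)
  - intros P [K hK].
    destruct (cot_surjective K) as [tK [tr eK]].
    assert (e0 : 0 < PI - tK) by lra.
    assert (ev := proj1 (filterlim_locally theta PI) tlim (mkposreal _ e0)).
    assert (pf : ProperFilter (right_end sM)).
    { destruct (right_end_finite sol) as [c [-> _]]; apply at_left_proper_filter. }
    assert (ev' : right_end sM (in_itv sm sM)).
    { apply (right_end_intro sm sM 0); auto. }
    destruct (filter_ex _ (filter_and _ _ ev ev')) as [s [h1 hs]].
    change (Rabs (theta s - PI) < PI - tK) in h1; apply Rabs_def2 in h1.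
    assert (sr := sol_theta_range _ _ _ _ _ _ sol s hs).
    assert (sK : cot s < K).
    { rewrite <- eK; apply cot_decreasing; lra. }
    unfold filtermap, at_left, within.
    generalize (open_gt (y s) M (below s hs)); apply filter_imp; intros t h2 h3.
    assert (ht : m < t < M) by (generalize (above s hs); lra).
    destruct (df' t ht) as [i [_ dt]]; apply hK.
    rewrite (is_derive_unique _ _ _ dt : Derive (fun t => x (g t)) t = cot (g t)).
    generalize (cot_lt s (g t) hs i (order s t hs ht h2)); lra.
  - intros P [K hK].
    destruct (cot_surjective K) as [tK [tr eK]].
    (* Taking the time from [theta_small] covers finite and infinite [sm] alike. *)
    destruct (theta_small mx pos tK (proj1 tr)) as [s [hs [_ h1]]].
    assert (sr := sol_theta_range _ _ _ _ _ _ sol s hs).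
    assert (sK : K < cot s).
    { rewrite <- eK; apply cot_decreasing; lra. }
    unfold filtermap, at_right, within.
    generalize (open_lt (y s) m (above s hs)); apply filter_imp; intros t h2 h3.
    assert (ht : m < t < M) by (generalize (below s hs); lra).
    destruct (df' t ht) as [i [_ dt]]; apply hK.
    rewrite (is_derive_unique _ _ _ dt : Derive (fun t => x (g t)) t = cot (g t)).
    generalize (cot_lt (g t) s i hs (order' s t hs ht h2)); lra.
Qed.

(* The initial heights from which the left end is not orthogonal to the
   boundary; the heights [5 <= y0] are put in by hand so that the set is
   nonempty without an existence theorem for maximal solutions. *)
Definition high_start (y0 : R) : Prop :=
  5 <= y0 \/
  exists (sm sM : Rbar) (x y theta : R -> R),
    maximal_solution y0 sm sM x y theta /\
    forall s, in_itv sm sM s -> 0 < excess y theta s.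

(** Completeness is applied to the negated heights: the member 5 makes the set nonempty, and the
    lower bound 1/2 makes the infimum positive. *)
Lemma high_start_infimum : exists H : R, 0 < H /\
  (forall a, high_start a -> H <= a) /\
  forall b, H < b -> exists a, high_start a /\ a < b.
Proof.
  destruct (completeness (fun z => high_start (- z))) as [l [ub least]].
  - exists (- (1 / 2)); intros z [ge|[sm [sM [x [y [theta [mx pos]]]]]]]; [lra|].
    generalize (half_lt_initial_height mx pos); lra.
  - exists (- 5); left; lra.
  - assert (lower : forall a, high_start a -> - l <= a).
    { intros a ha; assert (- a <= l); [|lra].
      apply ub; rewrite Ropp_involutive; exact ha. }
    exists (- l); split; [|split; [exact lower|]].
    + assert (l <= - (1 / 2)); [|lra].
      apply least; intros z [ge|[sm [sM [x [y [theta [mx pos]]]]]]]; [lra|].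
      generalize (half_lt_initial_height mx pos); lra.
    + intros b hb; apply NNPP; intros no.
      assert (l <= - b); [|lra].
      apply least; intros z hz; apply Rnot_lt_le; intros lt.
      apply no; exists (- z); split; [exact hz | lra].
Qed.

(** A strictly lower high start leaves a margin: [y0 - a] by the comparison at equal angles, or the
    height 1 when [5 <= a]. Positive excess by itself only gives [y > sin theta cos theta], which
    tends to 0 with [theta]. *)
Lemma high_start_below (a y0 : R) (sm sM : Rbar) (x y theta : R -> R) :
  high_start a -> a < y0 -> maximal_solution y0 sm sM x y theta ->
  (forall s, in_itv sm sM s -> 0 < excess y theta s) /\
  exists d, 0 < d /\ forall s, in_itv sm sM s -> d <= y s.
Proof.
  intros [ge|[sm1 [sM1 [x1 [y1 [t1 [mx1 pos1]]]]]]] lt mx; assert (sol := proj1 mx).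
  - assert (bd := height_ge_1 sol ltac:(lra)); split.
    (* The product [sin cos] is at most 1/2, while the height is at least 1. *)
    + intros s hs; generalize (bd s hs); unfold excess.
      generalize (pow2_ge_0 (sin (theta s) - cos (theta s))) (sin2_cos2 (theta s)).
      unfold Rsqr; simpl; nra.
    + exists 1; split; [lra | exact bd].
  - assert (cmp := height_comparison _ _ _ _ _ _ _ _ _ _ _ _ mx1 pos1 sol lt).
    split.
    + intros s hs; destruct (Rle_dec s 0) as [le|nle]; [apply cmp; assumption|].
      apply (excess_pos_of_nonneg sol); [exact hs | lra].
    + exists (y0 - a); split; [lra|]; intros s hs.
      destruct (Rle_dec s 0) as [le|nle]; [apply cmp; assumption|].
      generalize (y_increasing sol 0 s (in_itv_0 sol) hs ltac:(lra)).
      generalize (proj1 (cmp 0 (in_itv_0 sol) (Rle_refl 0))); lra.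
Qed.

Theorem theorem4p7 :
  (forall (y0 : R) (sm sM : Rbar) (x y theta : R -> R),
     0 < y0 -> maximal_solution y0 sm sM x y theta ->
     graph_on_y_axis sm sM x y) /\
  exists H : R, 0 < H /\
    forall (y0 : R) (sm sM : Rbar) (x y theta : R -> R),
      0 < y0 -> maximal_solution y0 sm sM x y theta ->
      (y0 < H ->
         approaches_boundary_orthogonally sm sM y theta /\
         exists Y : R, 0 < Y /\ horizontal_asymptote Y sm sM y theta) /\
      (H < y0 ->
         exists (m M : R) (f : R -> R),
           0 < m < M /\
           graph_over (fun t => m < t < M) f sm sM x y /\
           (forall t, m < t < M -> ex_derive f t) /\
           concave_on m M f /\
           filterlim (Derive f) (at_left M) (Rbar_locally m_infty) /\
           filterlim (Derive f) (at_right m) (Rbar_locally p_infty)).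
Proof.
  split.
  - intros y0 sm sM x y theta _ [sol _].
    exists (fun t => exists s, in_itv sm sM s /\ y s = t).
    destruct (trace_graph sol _ (fun t => iff_refl _)) as [g [graph _]].
    eexists; exact graph.
  - destruct high_start_infimum as [H [H0 [lower approx]]].
    exists H; split; [exact H0|].
    intros y0 sm sM x y theta _ mx; split; intros lt.
    + destruct (classic (exists s, in_itv sm sM s /\ excess y theta s <= 0))
        as [[s [hs neg]]|no].
      * destruct (orthogonal_left_end mx s hs neg) as [ly lt'].
        destruct (right_end_limits mx) as [Y [Y0 [ry [rt _]]]].
        split.
        -- exists (left_end sm); split; [left; reflexivity | auto].
        -- exists Y; split; [exact Y0|].
           exists (right_end sM); split; [right; reflexivity | auto].
      (* With positive excess throughout, [y0] would itself be a high start, so it could not lie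
         below the infimum. *)
      * assert (H <= y0); [|lra].
        apply lower; right; exists sm, sM, x, y, theta; split; [exact mx|].
        intros s hs; apply Rnot_le_lt; intros le; apply no; exists s; auto.
    (* Strictness of [H < y0] yields a high start strictly below [y0], whether or not the infimum is
       attained. *)
    + destruct (approx y0 lt) as [a [ha lta]].
      destruct (high_start_below a y0 sm sM x y theta ha lta mx) as [pos [d [d0 low]]].
      exact (concave_graph y0 d sm sM x y theta mx pos d0 low).
Qed.
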